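(* Let $\mathbb F_\Theta$ be a generalized flag manifold and $R_t$ the corresponding set of t-roots. Then any invariant almost complex structure $J$ on $\mathbb F_\Theta$ is determined by a set of signs $\{\varepsilon_\delta:\delta\in R_t\}$, $\varepsilon_\delta=\pm1$, satisfying $\varepsilon_\delta=-\varepsilon_{-\delta}$ for all $\delta\in R_t$, through $JX_\alpha=i\varepsilon_{k(\alpha)}X_\alpha$ for $\alpha\in R_M$. In particular, there exist $2^{|R_t^+|}$ invariant almost complex structures on $\mathbb F_\Theta$, and each of them is determined by exactly $|R_t^+|$ signs.
   Context: $\mathfrak g$ is a finite-dimensional complex semisimple Lie algebra, $\mathfrak h$ a Cartan subalgebra, $R$ the root system, $B$ the Killing form, $H_\alpha\in\mathfrak h$ the element with $\alpha(X)=B(X,H_\alpha)$, $\mathfrak h_{\mathbb R}$ the real span of the $H_\alpha$, $\Sigma$ a simple system, $R^\pm$ the positive/negative roots. For $\Theta\subset\Sigma$: $R_\Theta=\langle\Theta\rangle\cap R$, $R_\Theta^{\pm}=R_\Theta\cap R^{\pm}$, $R_M=R\setminus R_\Theta$, $R_M^+=R_M\cap R^+$. $G$ is a Lie group with Lie algebra $\mathfrak g$, $P_\Theta$ the normalizer in $G$ of $\mathfrak p_\Theta=\mathfrak h\oplus\sum_{\alpha\in R^+}\mathfrak g_\alpha\oplus\sum_{\alpha\in R_\Theta^-}\mathfrak g_\alpha$, and the flag manifold is $\mathbb F_\Theta=G/P_\Theta$. Fix a Weyl basis $X_\alpha\in\mathfrak g_\alpha$ ($B(X_\alpha,X_{-\alpha})=1$,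 $[X_\alpha,X_\beta]=n_{\alpha,\beta}X_{\alpha+\beta}$ with $n_{\alpha,\beta}$ real and nonzero iff $\alpha+\beta\in R$, $n_{\alpha,\beta}=-n_{-\alpha,-\beta}$). Put $\mathfrak u_\alpha=\mathrm{span}_{\mathbb R}\{X_\alpha-X_{-\alpha},\,i(X_\alpha+X_{-\alpha})\}$, $\mathfrak u=i\mathfrak h_{\mathbb R}\oplus\sum_{\alpha\in R^+}\mathfrak u_\alpha$ (a compact real form), $U\subset G$ the corresponding compact group, $K_\Theta=P_\Theta\cap U$, with Lie algebra $\mathfrak k_\Theta=i\mathfrak h_{\mathbb R}\oplus\sum_{\alpha\in R_\Theta^+}\mathfrak u_\alpha$. Then $\mathbb F_\Theta=U/K_\Theta$ with tangent space at the origin $\mathfrak m=\sum_{\alpha\in R_M^+}\mathfrak u_\alpha$. Put $\mathfrak t=\{H\in i\mathfrak h_{\mathbb R}:\alpha(H)=0\ \forall\alpha\in R_\Theta\}$, $k(\alpha)=\alpha|_{\mathfrak t}$; the t-roots are $R_t=k(R_M)$ and $R_t^+=k(R_M^+)$ is the set of positive t-roots. It is known that $\mathfrak m=\bigoplus_{\xi\in R_t^+}\mathfrak m_\xi$ with $\mathfrak m_\xi=\sum_{\alpha\in R_M^+,\,k(\alpha)=\xi}\mathfrak u_\alpha$, and that these are irreducible pairwise inequivalent $\mathrm{ad}(\mathfrak k_\Theta)$-modules. An invariant almost complex structure on $\mathbb F_\Theta$ is a $U$-invariant $(1,1)$-tensor field with square $-\mathrm{Id}$; equivalently, a linear map $J:\mathfrak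 m\to\mathfrak m$ with $J^2=-\mathrm{Id}$ and $\mathrm{ad}(L)J=J\,\mathrm{ad}(L)$ for all $L\in\mathfrak k_\Theta$. The same letter denotes its complex-linear extension to $\mathfrak m^{\mathbb C}$. *)

(* Defs.v *)
From HB Require Import structures.
From mathcomp Require Import all_boot all_order all_algebra finmap.
From mathcomp Require Import boolp classical_sets functions cardinality reals.
From mathcomp Require Import complex.

Set Implicit Arguments.
Unset Strict Implicit.
Unset Printing Implicit Defensive.

Import Order.TTheory GRing.Theory Num.Theory.
Local Open Scope fset_scope.
Local Open Scope ring_scope.

(** * Finite-dimensional Lie algebras *)

HB.mixin Record Vector_isLieAlgebra (K : fieldType) (V : Type)
    of Vector K V := {
  lie : V -> V -> V;
  lie_linearl : forall (z : V) (a : K) (x y : V),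
    lie (a *: x + y) z = a *: lie x z + lie y z;
  lie_linearr : forall (z : V) (a : K) (x y : V),
    lie z (a *: x + y) = a *: lie z x + lie z y;
  liexx : forall x : V, lie x x = 0;
  lie_jacobi : forall x y z : V,
    lie x (lie y z) + lie y (lie z x) + lie z (lie x y) = 0
}.

#[short(type="lieAlgType")]
HB.structure Definition LieAlgebra (K : fieldType) :=
  { V of Vector_isLieAlgebra K V & Vector K V }.

HB.instance Definition _ (K : fieldType) (g : lieAlgType K) (x : g) :=
  GRing.isLinear.Build K g g *:%R (lie x) (lie_linearr x).

Section LieTheory.
Variables (K : fieldType) (g : lieAlgType K).
Implicit Types (x y : g) (U V I h : {vspace g}).

Definition ad x : 'End(g) := linfun (lie x).

Definition lftrace (f : 'End(g)) : K :=
  \sum_i coord (vbasis fullv) i (f (tnth (vbasis fullv) i)).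

Definition killing x y : K := lftrace (ad x \o ad y)%VF.

(* The subspace [U, V] spanned by all brackets. *)
Definition lie_prod U V : {vspace g} :=
  <<[seq lie u v | u <- vbasis U, v <- vbasis V]>>%VS.

Definition lie_ideal I : bool := (lie_prod fullv I <= I)%VS.
Definition lie_subalgebra h : bool := (lie_prod h h <= h)%VS.
Definition lie_solvable I : Prop :=
  exists n, iter n (fun U => lie_prod U U) I = 0%VS.
Definition lie_nilpotent h : Prop :=
  exists n, iter n (lie_prod h) h = 0%VS.

Definition semisimple : Prop :=
  forall I, lie_ideal I -> lie_solvable I -> I = 0%VS.

(* Nilpotent and equal to its own normalizer. *)
Definition cartan_subalgebra h : Prop :=
  [/\ lie_subalgebra h, lie_nilpotent h &
      forall x, (forall y, y \in h -> lie x y \in h) -> x \in h].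

Definition dual h := 'Hom(subvs_of h, K^o).

Definition root_vector h (a : dual h) x : Prop :=
  forall H : subvs_of h, lie (vsval H) x = (a H : K) *: x.

Definition is_root h (a : dual h) : Prop :=
  a != 0 /\ exists2 x, x != 0 & root_vector a x.

End LieTheory.

Definition nat_comb (V : nmodType) (S : seq V) (v : V) : Prop :=
  exists c : V -> nat, v = \sum_(s <- S) s *+ c s.

Lemma mem_bigcapv (K : fieldType) (V : vectType K) (I : Type) (r : seq I)
    (U : I -> {vspace V}) (x : V) :
  (x \in (\bigcap_(i <- r) U i)%VS) = all (fun i => x \in U i) r.
Proof.
by elim: r => [|i r IHr]; rewrite ?big_nil ?memvf // big_cons memv_cap IHr.
Qed.

(** * Restriction of scalars from R[i] to R *)

Definition realif (R : realType) (V : vectType R[i]) : Type := V.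

Section Realif.
Variables (R : realType) (V : vectType R[i]).
Local Notation VR := (realif V).

HB.instance Definition _ := GRing.Zmodule.on VR.

Definition real_scale (a : R) (x : VR) : VR := a%:C%C *: (x : V).

Fact real_scaleA a b x : real_scale a (real_scale b x) = real_scale (a * b) x.
Proof. by rewrite /real_scale scalerA rmorphM. Qed.
Fact real_scale1 : left_id 1 real_scale.
Proof. by move=> x; rewrite /real_scale rmorph1 scale1r. Qed.
Fact real_scaleDr : right_distributive real_scale +%R.
Proof. by move=> a x y; rewrite /real_scale scalerDr. Qed.
Fact real_scaleDl x : {morph real_scale^~ x : a b / a + b}.
Proof. by move=> a b; rewrite /real_scale rmorphD scalerDl. Qed.

HB.instance Definition _ := GRing.Zmodule_isLmodule.Build R VR
  real_scaleA real_scale1 real_scaleDr real_scaleDl.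

Import VectorInternalTheory.
Local Notation dV := (dim V).

Definition realif_v2r (x : VR) : 'rV[R]_(dV + dV) :=
  row_mx (map_mx (@complex.Re R) (v2r (x : V)))
         (map_mx (@complex.Im R) (v2r (x : V))).
Definition realif_r2v (w : 'rV[R]_(dV + dV)) : VR :=
  r2v (\row_j (Complex (lsubmx w 0 j) (rsubmx w 0 j))) : V.

Fact realif_vector_axiom : Vector.axiom (dV + dV) VR.
Proof.
exists realif_v2r.
  move=> a x y; rewrite /realif_v2r linearP /= scale_row_mx add_row_mx.
  congr row_mx; apply/matrixP=> i j; rewrite !mxE.
    by case: (v2r _ i j) (v2r _ i j) => ? ? [? ?] /=; rewrite mul0r subr0.
  by case: (v2r _ i j) (v2r _ i j) => ? ? [? ?] /=; rewrite mul0r addr0.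
exists realif_r2v => [x|w].
  rewrite /realif_r2v /realif_v2r row_mxKl row_mxKr -[RHS](@v2rK _ V).
  by congr r2v; apply/rowP=> j; rewrite !mxE; case: (v2r _ _ _).
rewrite /realif_v2r /realif_r2v r2vK -[RHS]hsubmxK.
by congr row_mx; apply/rowP=> j; rewrite !mxE.
Qed.

HB.instance Definition _ := Lmodule_hasFinDim.Build R VR realif_vector_axiom.

End Realif.

(** * Flag manifolds *)

(* [killing_dual a] is H_a and [weyl a] is X_a; their values outside [roots] do
   not matter, since [weyl_coef a b] vanishes when [a + b] is not a root. *)
Record flag_data (R : realType) (g : lieAlgType R[i]) := FlagData {
  cartan : {vspace g};
  cartanP : cartan_subalgebra cartan;

  roots : {fset dual cartan};
  rootsP : forall a, a \in roots <-> is_root a;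

  killing_dual : dual cartan -> subvs_of cartan;
  killing_dualP : forall a, a \in roots -> forall H : subvs_of cartan,
    a H = killing (vsval H) (vsval (killing_dual a));

  simple : {fset dual cartan};
  simple_sub : simple `<=` roots;
  simple_free : free simple;
  simpleP : forall a, a \in roots ->
    nat_comb simple a \/ nat_comb simple (- a);

  theta : {fset dual cartan};
  theta_sub : theta `<=` simple;

  weyl : dual cartan -> g;
  weyl_coef : dual cartan -> dual cartan -> R;
  weyl_root : forall a, a \in roots -> root_vector a (weyl a);
  weyl_basis : (cartan + \sum_(a <- roots) <[weyl a]>)%VS = fullv;
  weyl_killing : forall a, a \in roots -> killing (weyl a) (weyl (- a)) = 1;
  weyl_lie : forall a b, a \in roots -> b \in roots -> a + b != 0 ->
    lie (weyl a) (weyl b) = (weyl_coef a b)%:C%C *: weyl (a + b);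
  weyl_coef_neq0 : forall a b, a \in roots -> b \in roots -> a + b != 0 ->
    (weyl_coef a b != 0) = (a + b \in roots);
  weyl_coefN : forall a b, a \in roots -> b \in roots -> a + b != 0 ->
    weyl_coef a b = - weyl_coef (- a) (- b)
}.

Arguments cartan {R g} _.
Arguments roots {R g} _.
Arguments killing_dual {R g} _ _.
Arguments simple {R g} _.
Arguments theta {R g} _.
Arguments weyl {R g} _ _.
Arguments weyl_coef {R g} _ _ _.

Section Flag.
Variables (R : realType) (g : lieAlgType R[i]) (F : flag_data g).
Local Notation C := R[i].
Local Notation h := (cartan F).
Local Notation X := (weyl F).
Local Notation gR := (realif g).
Local Notation CR := (realif C^o).
Implicit Types (a : dual h) (U : {vspace gR}).

Definition pos_roots : {fset dual h} :=
  [fset a in roots F | `[< nat_comb (simple F) a >]].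
Definition roots_theta : {fset dual h} :=
  [fset a in roots F | a \in <<theta F>>%VS].
Definition pos_roots_theta := roots_theta `&` pos_roots.
Definition roots_M := roots F `\` roots_theta.
Definition pos_roots_M := roots_M `&` pos_roots.

Definition u_ a : {vspace gR} :=
  <<[:: X a - X (- a); 'i%C *: (X a + X (- a))] : seq gR>>%VS.

(* i h_R, where h_R is the real span of the H_a. *)
Definition ihR : {vspace gR} :=
  <<[seq 'i%C *: vsval (killing_dual F a) | a <- roots F] : seq gR>>%VS.

Definition k_theta : {vspace gR} :=
  (ihR + \sum_(a <- pos_roots_theta) u_ a)%VS.

Definition m_ : {vspace gR} := (\sum_(a <- pos_roots_M) u_ a)%VS.

(* A functional on h, extended by 0 to a complement of h so that it can be
   evaluated at elements of i h_R, which is included in h. *)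
Definition root_eval a (x : gR) : CR := a (vsproj h (x : g)).

Fact root_eval_linear a : linear (root_eval a).
Proof. by move=> c x y; rewrite /root_eval !linearP. Qed.
HB.instance Definition _ a :=
  GRing.isLinear.Build R gR CR *:%R (root_eval a) (root_eval_linear a).

Definition t_ : {vspace gR} :=
  (ihR :&: \bigcap_(a <- roots_theta) lker (linfun (root_eval a)))%VS.

Definition dual_t := 'Hom(subvs_of t_, CR).

Definition kt a : dual_t := (linfun (root_eval a) \o linfun vsval)%VF.

Lemma mem_t (H : gR) :
  H \in t_ <->
  H \in ihR /\ forall a, a \in roots_theta -> root_eval a H = 0.
Proof.
have kerE a : (H \in lker (linfun (root_eval a))) = (root_eval a H == 0).
  by rewrite memv_ker lfunE.
rewrite /t_ memv_cap mem_bigcapv; split=> [/andP[-> /allP Hk]|[-> Hk]].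
  by split=> // a /Hk; rewrite kerE => /eqP.
by apply/allP => a /Hk /eqP; rewrite kerE.
Qed.

Lemma ktE a (H : subvs_of t_) : kt a H = root_eval a (vsval H).
Proof. by rewrite /kt comp_lfunE !lfunE. Qed.

Definition t_roots : {fset dual_t} := [fset kt a | a in roots_M].
Definition pos_t_roots : {fset dual_t} := [fset kt a | a in pos_roots_M].

(* [vsproj m_] is only a retyping, since [k_theta, m_] is included in m_. *)
Definition invariant_acs (J : 'End(subvs_of m_)) : Prop :=
  (J \o J)%VF = - \1%VF /\
  forall (L : gR) (x : subvs_of m_), L \in k_theta ->
    lie (L : g) (vsval (J x)) = vsval (J (vsproj m_ (lie (L : g) (vsval x)))).

(* m_ is contained in the compact real form of g, so its complexification is
   its complex span in g. *)
Definition mC : {vspace g} := <<(vbasis m_ : seq gR) : seq g>>%VS.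

Definition complex_extension (J : 'End(subvs_of m_)) (JC : 'End(subvs_of mC)) :
    Prop :=
  forall x : subvs_of m_,
    vsval (JC (vsproj mC (vsval x : gR))) = vsval (J x) :> g.

Definition sign_family (eps : dual_t -> R) : Prop :=
  forall d, d \in t_roots ->
    (eps d = 1 \/ eps d = -1) /\ eps d = - eps (- d).

Definition given_by (J : 'End(subvs_of m_)) (eps : dual_t -> R) : Prop :=
  exists2 JC : 'End(subvs_of mC), complex_extension J JC &
    forall a, a \in roots_M ->
      vsval (JC (vsproj mC (X a))) = ('i%C * (eps (kt a))%:C%C) *: X a.

End Flag.

(* Main.v *)
Require Import Defs.
From HB Require Import structures.
From mathcomp Require Import all_boot all_order all_algebra finmap.
From mathcomp Require Import boolp classical_sets functions cardinality reals.
From mathcomp Require Import complex ring.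

Set Implicit Arguments.
Unset Strict Implicit.
Unset Printing Implicit Defensive.

Import Order.TTheory GRing.Theory Num.Theory.
Local Open Scope fset_scope.
Local Open Scope classical_set_scope.
Local Open Scope ring_scope.

(* The Weyl basis gives c(H_a) = n_{-a,c}^2 - n_{a,c}^2 for roots c <> a, -a, so
   that c(H_a) is real and a + c is a root as soon as c(H_a) < 0.  Since J
   commutes with ad(i H_c) for all c, it preserves each u_a and multiplies X_a by
   i or -i; since it commutes with ad(u_b) for b in R_Theta, this scalar is the
   same at a and at a + b.  Two roots a, a' in R_M with the same restriction to t
   are joined by adding roots of R_Theta one at a time: a - a' is a sum of roots
   t of R_Theta, and positivity of the Killing form on h_R yields one with
   (a - a')(H_t) > 0, so that a - t or a' + t is again a root.  Hence the scalar
   only depends on k(a).  Conversely a sign family defines an operator commuting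
   with ad(k_Theta), because k(a + b) = k(a). *)

(** * The Killing form *)

(** Semisimplicity enters through one fact: the roots separate the points of h. Combined with B(H,
    H') = sum of c(H) c(H') over the roots c, it makes B positive definite on vectors where all
    roots take real values. The values c(H_a) must therefore be known to be real beforehand. Squares
    of structure constants give this for c different from a and -a, and a trace identity gives it
    for the remaining two.

    The obstacle in diagonalizing J is that it is only real-linear. Parametrize u_a by a complex
    number z. The coefficient of J at X_b is then a real-linear function of z, whose complex-linear
    part survives the commutation with every ad(i H_c) only for b = a, and whose antilinear part
    only for b = -a. The oddness of the signs comes from reality: an operator preserving the real
    space m has conjugate eigenvalues at a and -a, and the conjugate of i is -i.

    Equality of k(a) and k(a') is a real linear condition on i h_R. Real duality puts a - a' in the
    span of Theta; uniqueness of coordinates in the simple roots, which are integers for roots, then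
    makes it a finite sum. *)

Section KillingForm.
Variables (K : fieldType) (g : lieAlgType K).
Implicit Types (x y z : g) (f : 'End(g)).

Lemma lieDl x y z : lie (x + y) z = lie x z + lie y z.
Proof. by have := lie_linearl z 1 x y; rewrite !scale1r. Qed.

Lemma lie0l x : lie 0 x = 0.
Proof. by apply: (addrI (lie 0 x)); rewrite -lieDl !addr0. Qed.

Lemma lieZl a x y : lie (a *: x) y = a *: lie x y.
Proof. by have := lie_linearl y a x 0; rewrite lie0l !addr0. Qed.

Lemma lieZr a x y : lie x (a *: y) = a *: lie x y.
Proof. exact: linearZ. Qed.

Lemma lieNl x y : lie (- x) y = - lie x y.
Proof. by rewrite -!scaleN1r lieZl. Qed.

Lemma lie_suml I (r : seq I) (P : pred I) (F : I -> g) y :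
  lie (\sum_(i <- r | P i) F i) y = \sum_(i <- r | P i) lie (F i) y.
Proof. by apply: (big_morph (lie^~ y)) => [u v|]; rewrite ?lieDl ?lie0l. Qed.

Lemma lieC x y : lie x y = - lie y x.
Proof.
have := liexx (x + y); rewrite lieDl !linearD /= !liexx add0r addr0.
by move/eqP; rewrite addr_eq0 => /eqP.
Qed.

Lemma lie_lie x y z : lie (lie x y) z = lie x (lie y z) - lie y (lie x z).
Proof.
have := lie_jacobi x y z; rewrite (lieC z (lie x y)) => /eqP.
rewrite subr_eq0 => /eqP <-; congr (_ + _).
by rewrite (lieC z x) linearN.
Qed.

Lemma lftraceD f1 f2 : lftrace (f1 + f2) = lftrace f1 + lftrace f2.
Proof.
by rewrite -big_split; apply: eq_bigr => i _; rewrite add_lfunE linearD.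
Qed.

Lemma lftraceZ c f : lftrace (c *: f) = c * lftrace f.
Proof.
by rewrite mulr_sumr; apply: eq_bigr => i _; rewrite scale_lfunE linearZ.
Qed.

Lemma lftrace_is_linear : scalar (@lftrace K g).
Proof. by move=> c f1 f2; rewrite lftraceD lftraceZ. Qed.
HB.instance Definition _ :=
  GRing.isLinear.Build K 'End(g) K *%R (@lftrace K g) lftrace_is_linear.

Lemma lftrace_comp f1 f2 : lftrace (f1 \o f2)%VF = lftrace (f2 \o f1)%VF.
Proof.
pose e := vbasis (@fullv K g); pose a f i j := coord e i (f (tnth e j)).
have E p q : lftrace (p \o q)%VF = \sum_i \sum_j a p i j * a q j i.
  apply: eq_bigr => i _; rewrite comp_lfunE.
  rewrite {1}(coord_vbasis (memvf (q (tnth (vbasis fullv) i)))) !linear_sum /=.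
  apply: eq_bigr => j _; rewrite !linearZ /= mulrC.
  by rewrite -tnth_nth.
rewrite !E exchange_big; apply: eq_bigr => i _; apply: eq_bigr => j _.
exact: mulrC.
Qed.

(** The diagonal entries are the values of [phi] on the basis times the coordinates of [v]. [phi] is
    a bare function with a linearity hypothesis, so that composites such as
    [fun x => ev a (proj_h x)] can be supplied directly. *)
Lemma lftrace_rank1 f (phi : g -> K) v :
  scalar phi -> (forall x, f x = phi x *: v) -> lftrace f = phi v.
Proof.
move=> phi_lin fE.
pose L := GRing.isLinear.Build K g K *%R phi phi_lin.
pose phi' : {scalar g} := HB.pack phi L.
rewrite -[phi v]/(phi' v) (coord_vbasis (memvf v)) linear_sum /=.
have phiZ c u : phi (c *: u) = c * phi u by rewrite -[LHS]/(phi' _) linearZ.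
apply: eq_bigr => i _; rewrite fE phiZ linearZ /= mulrC.
by rewrite -tnth_nth.
Qed.

Lemma killingC x y : killing x y = killing y x.
Proof. exact: lftrace_comp. Qed.

Lemma adE x y : ad x y = lie x y. Proof. exact: lfunE. Qed.

Lemma killing_is_scalar x : scalar (killing x).
Proof.
move=> c y z; rewrite /killing -lftraceZ -lftraceD; congr lftrace.
by apply/lfunP=> v; rewrite !(comp_lfunE, scale_lfunE, add_lfunE, adE) lieDl
  lieZl linearD linearZ.
Qed.
HB.instance Definition _ x :=
  GRing.isLinear.Build K g K *%R (killing x) (killing_is_scalar x).

Lemma killingZl c x y : killing (c *: x) y = c * killing x y.
Proof. by rewrite killingC linearZ /= killingC. Qed.

Lemma killingZr c x y : killing x (c *: y) = c * killing x y.
Proof. exact: linearZ. Qed.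

Lemma killingDl x y z : killing (x + y) z = killing x z + killing y z.
Proof. by rewrite killingC linearD /= !(killingC z). Qed.

Lemma killingNl x z : killing (- x) z = - killing x z.
Proof. by rewrite -scaleN1r killingZl mulN1r. Qed.

(** Both sides contain tr(xyz); the remaining terms tr(yxz) and tr(xzy) agree by cyclicity of the
    trace. *)
Lemma killing_lie x y z : killing (lie x y) z = killing x (lie y z).
Proof.
rewrite /killing.
have -> : (ad (lie x y) \o ad z =
    (ad x \o (ad y \o ad z)) - ((ad y \o ad x) \o ad z))%VF.
  by apply/lfunP=> v; rewrite !(comp_lfunE, add_lfunE, opp_lfunE, adE) lie_lie.
have -> : (ad x \o ad (lie y z) =
    (ad x \o (ad y \o ad z)) - (ad x \o (ad z \o ad y)))%VF.
  apply/lfunP=> v; rewrite !(comp_lfunE, add_lfunE, opp_lfunE, adE) lie_lie.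
  by rewrite linearB.
rewrite !linearB /=; congr (_ - _).
by rewrite -comp_lfunA lftrace_comp -comp_lfunA.
Qed.

Lemma lie_prodP (U V : {vspace g}) (W : {vspace g}) :
  (forall u v, u \in U -> v \in V -> lie u v \in W) -> (lie_prod U V <= W)%VS.
Proof.
move=> UVW; apply/span_subvP => _ /allpairsP[[u v] [/= uU vV ->]].
by apply: UVW; apply: vbasis_mem.
Qed.

Lemma mem_lie_prod (U V : {vspace g}) u v :
  u \in U -> v \in V -> lie u v \in lie_prod U V.
Proof.
move=> uU vV; rewrite (coord_vbasis uU) (coord_vbasis vV) lie_suml.
apply: rpred_sum => i _; rewrite lieZl linear_sum rpredZ // rpred_sum // => j _.
rewrite linearZ rpredZ // memv_span //.
by apply: (allpairs_f lie); apply: mem_nth; rewrite size_tuple.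
Qed.

Lemma lie_prodS (U U' V V' : {vspace g}) :
  (U <= U')%VS -> (V <= V')%VS -> (lie_prod U V <= lie_prod U' V')%VS.
Proof.
move=> /subvP sU /subvP sV; apply: lie_prodP => u v /sU uU /sV vV.
exact: mem_lie_prod.
Qed.

End KillingForm.

Section ConjC.
Variable R : realType.
Implicit Types p q : R[i].

Lemma conjcD p q : (p + q)^*%C = p^*%C + q^*%C.
Proof. exact: rmorphD. Qed.

Lemma conjcN p : (- p)^*%C = - p^*%C.
Proof. exact: rmorphN. Qed.

Lemma conjcM p q : (p * q)^*%C = p^*%C * q^*%C.
Proof. exact: rmorphM. Qed.

Lemma conjci : 'i%C^*%C = - 'i%C :> R[i].
Proof. by apply/eqP; rewrite eq_complex /= oppr0 !eqxx. Qed.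

Lemma mulcii : 'i%C * 'i%C = -1 :> R[i].
Proof. by rewrite -expr2 sqr_i. Qed.

Lemma i_neq0 : 'i%C != 0 :> R[i].
Proof. by rewrite complexiE neq0Ci. Qed.

End ConjC.

(** * Weyl bases *)

Section RootData.
Variables (R : realType) (g : lieAlgType R[i]) (F : flag_data g).
Hypothesis g_semisimple : semisimple g.
Local Notation C := R[i].
Local Notation h := (cartan F).
Local Notation Rt := (Defs.roots F).
Local Notation X := (weyl F).
Local Notation N := (weyl_coef F).
Implicit Types (a b c : dual h) (x y H : g).

(** Convertible with [root_eval a], but linear over C on [g]; facts about [t_] are read through it
    by a mere change of type. *)
Definition ev a x : C := a (vsproj h x).
Definition Hd a : g := vsval (killing_dual F a).

Lemma ev_is_scalar a : scalar (ev a).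
Proof. by move=> k x y; rewrite /ev !linearP. Qed.
HB.instance Definition _ a :=
  GRing.isLinear.Build C g C *%R (ev a) (ev_is_scalar a).

Lemma evDl a b x : ev (a + b) x = ev a x + ev b x.
Proof. by rewrite /ev add_lfunE. Qed.
Lemma evNl a x : ev (- a) x = - ev a x.
Proof. by rewrite /ev opp_lfunE. Qed.
Lemma evBl a b x : ev (a - b) x = ev a x - ev b x.
Proof. by rewrite evDl evNl. Qed.
Lemma evZl k a x : ev (k *: a) x = k * ev a x.
Proof. by rewrite /ev scale_lfunE. Qed.
Lemma ev_suml I (r : seq I) (P : pred I) (f : I -> dual h) x :
  ev (\sum_(i <- r | P i) f i) x = \sum_(i <- r | P i) ev (f i) x.
Proof. by rewrite /ev sum_lfunE. Qed.

Lemma ev_eq0 a : (forall H, H \in h -> ev a H = 0) -> a = 0.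
Proof.
move=> a0; apply/lfunP=> H; rewrite zero_lfunE -[H]vsvalK; apply: a0.
exact: subvsP.
Qed.

Lemma Hd_h a : Hd a \in h.
Proof. exact: subvsP. Qed.
Hint Resolve Hd_h : core.

Lemma ev_killing a H : a \in Rt -> H \in h -> ev a H = killing H (Hd a).
Proof. by move=> aR Hh; rewrite /ev (killing_dualP aR) vsprojK. Qed.

Lemma lie_hX a H : a \in Rt -> H \in h -> lie H (X a) = ev a H *: X a.
Proof. by move=> aR Hh; have := weyl_root aR (vsproj h H); rewrite vsprojK. Qed.

Lemma root_neq0 a : a \in Rt -> a != 0.
Proof. by move=> /rootsP[]. Qed.

Lemma weyl_neq0 a : a \in Rt -> X a != 0.
Proof.
move=> /weyl_killing; apply: contra_eq_neq => ->.
by rewrite killingC linear0 eq_sym oner_eq0.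
Qed.

Lemma sumv_seqP (K : fieldType) (V : vectType K) (I : eqType) (r : seq I)
    (U : I -> {vspace V}) (P : V -> Prop) :
    P 0 -> (forall u v, P u -> P v -> P (u + v)) ->
    (forall i u, i \in r -> u \in U i -> P u) ->
  forall v, v \in (\sum_(i <- r) U i)%VS -> P v.
Proof.
move=> P0 PD; elim: r => [|i r IHr] PU v.
  by rewrite big_nil memv0 => /eqP->.
rewrite big_cons => /memv_addP[u uU [w wU ->]]; apply: PD.
  by apply: PU uU; rewrite mem_head.
by apply: IHr wU => j x jr; apply: PU; rewrite in_cons jr orbT.
Qed.

Lemma weyl_ind (P : g -> Prop) :
    (forall u v, P u -> P v -> P (u + v)) ->
    (forall H, H \in h -> P H) ->
    (forall a k, a \in Rt -> P (k *: X a)) ->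
  forall x, P x.
Proof.
move=> PD Ph PX x.
have /memv_addP[H Hh [v vX ->]] : x \in (h + \sum_(a <- Rt) <[X a]>)%VS.
  by rewrite weyl_basis memvf.
apply: (PD); first exact: Ph.
apply: (sumv_seqP _ PD _ vX) => [|a u aR /vlineP[k ->]]; last exact: PX.
by apply: Ph; rewrite mem0v.
Qed.

(** [H] and [H'] both act on [X a] by scalars, so their commutator acts on it by 0. *)
Lemma ev_lie a H H' : a \in Rt -> H \in h -> H' \in h -> ev a (lie H H') = 0.
Proof.
move=> aR Hh H'h.
have hh : lie H H' \in h.
  have [/subvP h_sub _ _] := cartanP F.
  exact/h_sub/mem_lie_prod.
apply/eqP; have /eqP := lie_hX aR hh.
rewrite lie_lie !(lie_hX aR) // !lieZr !(lie_hX aR) // !scalerA mulrC.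
by rewrite subrr eq_sym scaler_eq0 (negPf (weyl_neq0 aR)) orbF.
Qed.

(* The common kernel of the roots is a nilpotent ideal. *)
Lemma root_separating H : H \in h -> (forall a, a \in Rt -> ev a H = 0) -> H = 0.
Proof.
pose Z : {vspace g} := (h :&: \bigcap_(a <- Rt) lker (linfun (ev a : g -> C^o)))%VS.
have memZ x : (x \in Z) <-> x \in h /\ forall a, a \in Rt -> ev a x = 0.
  rewrite memv_cap mem_bigcapv; split=> [/andP[xh /allP xk]|[-> xk]].
    by split=> // a /xk; rewrite memv_ker lfunE => /eqP.
  by apply/allP => a /xk xa; rewrite memv_ker lfunE /= xa.
move=> Hh H0; have : H \in Z by apply/memZ.
suff -> : Z = 0%VS by rewrite memv0 => /eqP.
have [h_sub [n hn] _] := cartanP F.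
have Zh : (Z <= h)%VS by apply: capvSl.
apply: g_semisimple.
  apply: lie_prodP => x y _ /memZ[yh y0]; elim/weyl_ind: x.
  - by move=> u v uZ vZ; rewrite lieDl rpredD.
  - move=> H' H'h; apply/memZ; split=> [|a aR]; last by rewrite ev_lie.
    by apply: (subvP h_sub); exact: mem_lie_prod.
  - by move=> a k aR; rewrite lieZl lieC lie_hX // y0 // scale0r oppr0 scaler0 mem0v.
(* The derived series of [Z] stays inside [Z], hence inside [h], so it is bounded term by term by
   the lower central series of [h]. *)
exists n; apply/eqP; rewrite -subv0 -hn.
elim: n {hn} => //= n IHn.
apply: lie_prodS IHn; apply: (subv_trans _ Zh).
elim: n => //= n IHn; apply: subv_trans (lie_prodS IHn IHn) _.
apply: lie_prodP => x y /memZ[xh _] /memZ[yh _]; apply/memZ; split.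
  by apply: (subvP h_sub); exact: mem_lie_prod.
by move=> a aR; rewrite ev_lie.
Qed.

Lemma cartan_abelian H H' : H \in h -> H' \in h -> lie H H' = 0.
Proof.
move=> Hh H'h; apply: root_separating => [|a aR]; last exact: ev_lie.
have [/subvP h_sub _ _] := cartanP F.
exact/h_sub/mem_lie_prod.
Qed.

Lemma mem_cartan x : (forall H, H \in h -> lie x H = 0) -> x \in h.
Proof.
move=> x0; have [_ _ h_norm] := cartanP F.
by apply: h_norm => H Hh; rewrite x0 // mem0v.
Qed.

Lemma root_ev_neq0 a : a != 0 -> exists2 H, H \in h & ev a H != 0.
Proof.
move=> a0; apply: contra_notP (elimN eqP a0) => nex; apply: ev_eq0 => H Hh.
by apply/eqP/contraT => aH; case: nex; exists H.
Qed.

Lemma killing_hX H a : H \in h -> a \in Rt -> killing H (X a) = 0.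
Proof.
move=> Hh aR; have [H' H'h aH'] := root_ev_neq0 (root_neq0 aR).
apply: (mulfI aH'); rewrite mulr0.
by rewrite -killingZr -lie_hX // -killing_lie cartan_abelian // killingC linear0.
Qed.

Lemma killing_XX a b : a \in Rt -> b \in Rt -> a + b != 0 ->
  killing (X a) (X b) = 0.
Proof.
move=> aR bR /root_ev_neq0[H Hh]; rewrite evDl => abH.
apply: (mulfI abH); rewrite mulr0 mulrDl.
rewrite -killingZl -lie_hX // lieC killingNl killing_lie lie_hX //.
by rewrite linearZ /= addNr.
Qed.

(** Otherwise [X a] would be orthogonal to [h] and to every root vector, hence to all of [g]; but
    [weyl_killing] pairs it to 1 with the vector [X (- a)], whatever that vector is. *)
Lemma root_opp a : a \in Rt -> - a \in Rt.
Proof.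
move=> aR; apply/contraT => NaR.
have : killing (X a) (X (- a)) == 0.
  rewrite killingC; apply/eqP; elim/weyl_ind: (X (- a)) => [u v u0 v0|H Hh|b k bR].
  - by rewrite killingDl u0 v0 addr0.
  - exact: killing_hX.
  - rewrite killingZl killing_XX ?mulr0 //; apply: contraNneq NaR => ba.
    by rewrite -(addrK a b) ba sub0r in bR.
by rewrite weyl_killing // oner_eq0.
Qed.

(** The bracket commutes with [h], which is its own normalizer, so it lies in [h]. There it is
    determined by its pairings with the H_c, and invariance computes these as a(H_c). *)
Lemma lie_XN a : a \in Rt -> lie (X a) (X (- a)) = Hd a.
Proof.
move=> aR; have NaR := root_opp aR.
have XXh : lie (X a) (X (- a)) \in h.
  apply: mem_cartan => H Hh; rewrite lie_lie !(lieC _ H) !lie_hX // evNl.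
  by rewrite -!scaleNr opprK !lieZr (lieC (X (- a))) scalerN !scaleNr opprK subrr.
apply/eqP; rewrite -subr_eq0; apply/eqP; apply: root_separating => [|c cR].
  by rewrite rpredB.
rewrite ev_killing ?rpredB // killingC linearB /=.
rewrite -killing_lie lie_hX // killingZl weyl_killing // mulr1.
by rewrite ev_killing // subrr.
Qed.

Lemma ev_HdC a b : a \in Rt -> b \in Rt -> ev a (Hd b) = ev b (Hd a).
Proof. by move=> aR bR; rewrite !ev_killing // killingC. Qed.

Lemma killing_XN a b : a \in Rt -> b \in Rt ->
  killing (X a) (X (- b)) = (a == b)%:R.
Proof.
move=> aR bR; have [->|nab] := eqVneq; first exact: weyl_killing.
by rewrite killing_XX ?root_opp // subr_eq0.
Qed.

Lemma weyl_decomp x : exists2 H, H \in h &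
  x = H + \sum_(a <- Rt) killing x (X (- a)) *: X a.
Proof.
elim/weyl_ind: x => [u v [H Hh uE] [H' H'h vE]|H Hh|b k bR].
- exists (H + H'); first exact: rpredD.
  rewrite {1}uE {1}vE addrACA; congr (_ + _); rewrite -big_split.
  apply: eq_bigr => a _ /=.
  by rewrite -scalerDl -killingDl.
- exists H => //; rewrite big1_seq ?addr0 // => a aR.
  by rewrite killing_hX ?scale0r ?root_opp.
- exists 0; rewrite ?mem0v // add0r (big_fsetD1 b) //= big1_seq => [|a].
    by rewrite addr0 killingZl weyl_killing // mulr1.
  rewrite /= in_fsetD1 => /andP[nab aR].
  by rewrite killingZl killing_XN // eq_sym (negPf nab) mulr0 scale0r.
Qed.

(** Invariance computes B([X_{-a}, X_{a+c}], X_{-c}) also as -n_{-a,-c}. This equality is what makes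
    ad(X_{-a}) ad(X_a) act on X_c by a square. *)
Lemma weyl_coef_shift a c : a \in Rt -> c \in Rt -> a + c \in Rt ->
  N (- a) (a + c) = N a c.
Proof.
move=> aR cR acR; have ac0 := root_neq0 acR; apply: complexI.
have NaR := root_opp aR; have NcR := root_opp cR.
transitivity (killing (lie (X (- a)) (X (a + c))) (X (- c))).
  by rewrite weyl_lie ?addKr ?root_neq0 // killingZl weyl_killing // mulr1.
rewrite lieC killingNl killing_lie weyl_lie // -?opprD ?oppr_eq0 //.
by rewrite killingZr weyl_killing // mulr1 (weyl_coefN aR cR) // rmorphN.
Qed.

Lemma weyl_coef_eq0 a c : a \in Rt -> c \in Rt -> a + c != 0 ->
  a + c \notin Rt -> N a c = 0.
Proof.
move=> aR cR ac0; rewrite -(weyl_coef_neq0 aR cR ac0) => /negPn.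
by move/eqP.
Qed.

Lemma lie_lie_weyl a c : a \in Rt -> c \in Rt -> a + c != 0 ->
  lie (X (- a)) (lie (X a) (X c)) = (N a c ^+ 2)%:C%C *: X c.
Proof.
move=> aR cR ac0; rewrite weyl_lie // lieZr.
have [acR|acR] := boolP (a + c \in Rt); last first.
  by rewrite (weyl_coef_eq0 aR cR ac0 acR) expr0n scale0r scale0r.
rewrite weyl_lie ?root_opp ?addKr ?root_neq0 // weyl_coef_shift //.
by rewrite scalerA -rmorphM expr2.
Qed.

(** Expand [H_a, X_c] = [[X_a, X_{-a}], X_c] by the Jacobi identity. The two exclusions keep [a + c]
    and [- a + c] nonzero, where [weyl_lie] applies. *)
Lemma ev_Hd a c : a \in Rt -> c \in Rt -> c != a -> c != - a ->
  ev c (Hd a) = (N (- a) c ^+ 2 - N a c ^+ 2)%:C%C.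
Proof.
move=> aR cR nca ncNa; have NaR := root_opp aR.
apply/eqP; rewrite -subr_eq0; have := weyl_neq0 cR; apply: contraNT => nE.
rewrite -(inj_eq (scalerI nE)) scaler0 scalerBl -lie_hX // -lie_XN // lie_lie.
rewrite lie_lie_weyl //; last by rewrite addrC addr_eq0.
have := lie_lie_weyl NaR cR; rewrite opprK => ->.
  by rewrite -scalerBl -rmorphB subrr.
by rewrite addrC subr_eq0 nca.
Qed.

(** * Traces in the Weyl basis and positivity of the Killing form *)

Definition rank1 (u v x : g) : g := killing u x *: v.
Lemma rank1_is_linear u v : linear (rank1 u v).
Proof. by move=> k x y; rewrite /rank1 linearP scalerDl scalerA. Qed.
HB.instance Definition _ u v :=
  GRing.isLinear.Build C g g *:%R (rank1 u v) (rank1_is_linear u v).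

Definition proj_h : 'End(g) :=
  \1%VF - \sum_(a <- Rt) linfun (rank1 (X (- a)) (X a)).

Lemma proj_hE x : proj_h x = x - \sum_(a <- Rt) killing x (X (- a)) *: X a.
Proof.
rewrite add_lfunE opp_lfunE id_lfunE sum_lfunE; congr (_ - _).
by apply: eq_bigr => a _; rewrite lfunE /= /rank1 killingC.
Qed.

Lemma mem_proj_h x : proj_h x \in h.
Proof. by rewrite proj_hE; have [H Hh {1}->] := weyl_decomp x; rewrite addrK. Qed.

Lemma proj_h_id H : H \in h -> proj_h H = H.
Proof.
move=> Hh; rewrite proj_hE big1_seq ?subr0 // => a aR.
by rewrite killing_hX ?scale0r ?root_opp.
Qed.

(** The identity is [proj_h] plus the rank-one projections x -> B(X_{-c}, x) X_c. The part on [h] is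
    left as a trace: where the formula is applied, that operator is zero or of rank one, so no basis
    of [h] has to be chosen. *)
Lemma lftrace_weyl (f : 'End(g)) :
  lftrace f = lftrace (f \o proj_h)%VF + \sum_(c <- Rt) killing (f (X c)) (X (- c)).
Proof.
pose p c := linfun (rank1 (X (- c)) (X c)).
have -> : lftrace f = lftrace ((f \o proj_h)%VF + \sum_(c <- Rt) (f \o p c)%VF).
  congr lftrace; apply/lfunP => x; rewrite add_lfunE comp_lfunE proj_hE linearB /=.
  rewrite sum_lfunE; set S := \sum_(_ <- _) _; set T := \sum_(_ <- _) _.
  suff -> : T = f S by rewrite subrK.
  rewrite linear_sum; apply: eq_bigr => c _.
  by rewrite comp_lfunE lfunE /= /rank1 killingC.
rewrite linearD linear_sum; congr (_ + _); apply: eq_bigr => c _ /=.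
rewrite killingC; apply: (lftrace_rank1 (phi := killing (X (- c)))) => [|x].
  exact: killing_is_scalar.
by rewrite comp_lfunE lfunE /= /rank1 linearZ.
Qed.

Lemma killing_sum H H' : H \in h -> H' \in h ->
  killing H H' = \sum_(c <- Rt) ev c H * ev c H'.
Proof.
move=> Hh H'h; rewrite {1}/killing lftrace_weyl.
have -> : ((ad H \o ad H') \o proj_h)%VF = 0.
  apply/lfunP=> x; rewrite !comp_lfunE !adE (cartan_abelian H'h) ?mem_proj_h //.
  by rewrite linear0 zero_lfunE.
rewrite linear0 add0r; apply: eq_big_seq => c cR.
by rewrite !comp_lfunE !adE lie_hX // lieZr lie_hX // scalerA killingZl
  weyl_killing // mulr1 mulrC.
Qed.

(* The identity [1 = B(X_a, X_{-a})], with the trace computed in the Weyl basis,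
   reads [1 = 2 a(H_a) + sum of squares of the n_{-a,c}]. *)
Lemma ev_Hd_self_real a : a \in Rt -> ev a (Hd a) \is Num.real.
Proof.
move=> aR; have NaR := root_opp aR.
have := weyl_killing aR; rewrite {1}/killing lftrace_weyl (big_fsetD1 a) //=.
(* The first of the two copies of a(H_a): on [h] the operator is x -> a(x) H_a. *)
have -> : lftrace ((ad (X a) \o ad (X (- a))) \o proj_h)%VF = ev a (Hd a).
  rewrite -[in RHS](proj_h_id (Hd_h a)).
  apply: (lftrace_rank1 (phi := fun x => ev a (proj_h x))) => [k x y|x].
    by rewrite !linearP.
  rewrite !comp_lfunE !adE [lie (X (- a)) _]lieC lie_hX ?mem_proj_h // evNl.
  by rewrite -scaleNr opprK lieZr lie_XN.
(* The second copy is the term c = a, since [X_a, [X_{-a}, X_a]] = [H_a, X_a]. *)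
rewrite !comp_lfunE !adE (lieC (X (- a))) lie_XN // linearN /= lieC opprK.
rewrite lie_hX // killingZl weyl_killing // mulr1 addrA -mulr2n -mulr_natl.
set s := \sum_(_ <- _) _ => E.
have sR : s \is Num.real.
  rewrite /s big_seq; apply: rpred_sum => c; rewrite in_fsetD1 => /andP[nca cR].
  rewrite !comp_lfunE !adE; have := lie_lie_weyl NaR cR; rewrite opprK => ->.
    rewrite killingZl weyl_killing // mulr1; exact/complex_realP/ex_intro.
  by rewrite addrC subr_eq0 nca.
have -> : ev a (Hd a) = (2%:R * ev a (Hd a) + s - s) / 2%:R.
  by rewrite addrK mulrAC divff ?mul1r ?pnatr_eq0.
by rewrite E rpred_div ?rpredB ?rpred1 ?rpred_nat.
Qed.

Lemma ev_Hd_real a c : a \in Rt -> c \in Rt -> ev c (Hd a) \is Num.real.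
Proof.
move=> aR cR; have [->|nca] := eqVneq c a; first exact: ev_Hd_self_real.
have [->|ncNa] := eqVneq c (- a); first by rewrite evNl rpredN ev_Hd_self_real.
rewrite ev_Hd //; exact/complex_realP/ex_intro.
Qed.

Lemma addr_root a c : a \in Rt -> c \in Rt -> c != a -> c != - a ->
  ev c (Hd a) < 0 -> a + c \in Rt.
Proof.
move=> aR cR nca ncNa; rewrite ev_Hd // ltcR subr_lt0 => lt.
rewrite -weyl_coef_neq0 // -1?sqrf_eq0; last by rewrite addrC addr_eq0.
by rewrite gt_eqF // (le_lt_trans _ lt) // sqr_ge0.
Qed.

(** By [killing_sum] the value is a sum of squares of real numbers; if it vanishes, every root
    vanishes at [H], and the roots separate points. *)
Lemma killing_gt0 H : H \in h -> (forall a, a \in Rt -> ev a H \is Num.real) ->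
  H != 0 -> 0 < killing H H.
Proof.
move=> Hh Hreal H0; rewrite lt_neqAle eq_sym killing_sum //.
have sq_ge0 c : c \in Rt -> 0 <= ev c H * ev c H.
  by move=> cR; rewrite -expr2 real_exprn_even_ge0 // Hreal.
rewrite big_seq sumr_ge0 // andbT; apply: contraNneq H0 => s0.
apply/eqP/root_separating => // a aR.
apply/eqP; rewrite -sqrf_eq0 expr2.
by move/eqP: s0; rewrite psumr_eq0 // => /allP/(_ a aR)/implyP/(_ aR).
Qed.

(** * Roots and t-roots *)

Local Notation Rtheta := (roots_theta F).
Local Notation RM := (roots_M F).

Lemma mem_Rtheta a : (a \in Rtheta) = (a \in Rt) && (a \in <<theta F>>%VS).
Proof. by rewrite !inE. Qed.

Lemma mem_RM a : (a \in RM) = (a \in Rt) && (a \notin <<theta F>>%VS).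
Proof. by rewrite in_fsetD mem_Rtheta; case: (a \in Rt) => //=; rewrite andbT. Qed.

Lemma RM_root a : a \in RM -> a \in Rt.
Proof. by rewrite mem_RM => /andP[]. Qed.
Lemma Rtheta_root a : a \in Rtheta -> a \in Rt.
Proof. by rewrite mem_Rtheta => /andP[]. Qed.
Lemma Rtheta_span a : a \in Rtheta -> a \in <<theta F>>%VS.
Proof. by rewrite mem_Rtheta => /andP[]. Qed.

Lemma RthetaN a : a \in Rtheta -> - a \in Rtheta.
Proof. by rewrite !mem_Rtheta rpredN => /andP[/root_opp-> ->]. Qed.

Lemma RMN a : a \in RM -> - a \in RM.
Proof. by rewrite !mem_RM rpredN => /andP[/root_opp-> ->]. Qed.

Lemma RM_add a b : a \in RM -> b \in Rtheta -> a + b \in Rt -> a + b \in RM.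
Proof.
rewrite !mem_RM => /andP[_ aT] /Rtheta_span bT ->.
by rewrite rpredDr.
Qed.

Lemma RM_neq_theta a b : a \in RM -> b \in Rtheta -> a != b /\ a != - b.
Proof.
rewrite mem_RM => /andP[_ aT] /Rtheta_span bT.
by split; apply: contraNneq aT => ->; rewrite ?rpredN.
Qed.

Lemma kt_eqP a b :
  kt a = kt b <-> forall H : g, (H : realif g) \in t_ F -> ev a H = ev b H.
Proof.
split=> [ab H Ht|ab]; last first.
  by apply/lfunP => H; rewrite !ktE; apply: ab; exact: subvsP.
by have /lfunP/(_ (vsproj (t_ F) H)) := ab; rewrite !ktE vsprojK.
Qed.

Lemma ktD a b : kt (a + b) = kt a + kt b.
Proof. by apply/lfunP => H; rewrite add_lfunE !ktE; exact: evDl. Qed.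

Lemma ktN a : kt (- a) = - kt a.
Proof. by apply/lfunP => H; rewrite opp_lfunE !ktE; exact: evNl. Qed.

Lemma kt_theta b : b \in Rtheta -> kt b = 0.
Proof.
move=> bT; apply/lfunP=> H; rewrite zero_lfunE ktE.
by have /mem_t[_] := subvsP H; apply.
Qed.

(** * From equal restrictions to t to sums of roots of R_Theta *)

Lemma ker_sub_colP (K : fieldType) (m n : nat) (A : 'M[K]_(n, m)) (c : 'cV[K]_n) :
  (forall w : 'rV_n, w *m A = 0 -> w *m c = 0) -> exists D, c = A *m D.
Proof.
move=> Ac; suff /submxP[D cD] : (c^T <= A^T)%MS.
  by exists D^T; rewrite -[c]trmxK cD trmx_mul trmxK.
rewrite submxE -[_ *m _]trmxK trmx_mul trmxK trmx_eq0; apply/eqP/row_matrixP => i.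
rewrite row_mul row0; apply: Ac; rewrite -row_mul.
by rewrite -[X in _ *m X]trmxK -trmx_mul mulmx_coker trmx0 row0.
Qed.

(** Double annihilator over R. [A] and [c] hold the values at the H_e, for e in R, of the roots of
    R_Theta and of a - b; [Re] loses nothing, as these values are real. If the left kernel of [A]
    kills [c], then [c] is a real combination of the columns of [A]. *)
Lemma kt_span a b : a \in Rt -> b \in Rt -> kt a = kt b ->
  a - b \in <<theta F>>%VS.
Proof.
move=> aR bR /kt_eqP ktab.
pose ss : seq (dual h) := Rt; pose rs : seq (dual h) := Rtheta.
have ssR (i : 'I_(size ss)) : ss`_i \in Rt by apply: mem_nth.
have rsT (j : 'I_(size rs)) : rs`_j \in Rtheta by apply: mem_nth.
have rsR j := Rtheta_root (rsT j).
pose A := \matrix_(i < size ss, j < size rs) complex.Re (ev rs`_j (Hd ss`_i)).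
pose c := \col_(i < size ss)
  (complex.Re (ev a (Hd ss`_i)) - complex.Re (ev b (Hd ss`_i))).
have [w wA|D cD] := @ker_sub_colP _ _ _ A c.
  (* A real row [w] is the coordinate vector of an element of i h_R, and w A = 0 says that this
     element lies in t. *)
  pose H : g := \sum_i (w 0 i)%:C%C *: ('i%C *: Hd ss`_i).
  have evH d : d \in Rt ->
      ev d H = 'i%C * (\sum_i w 0 i * complex.Re (ev d (Hd ss`_i)))%:C%C.
    move=> dR; rewrite linear_sum rmorph_sum mulr_sumr; apply: eq_bigr => i _ /=.
    rewrite !linearZ /= mulrCA rmorphM; congr (_ * (_ * _)).
    by rewrite /= RRe_real // ev_Hd_real.
  have Ht : (H : realif g) \in t_ F.
    apply/mem_t; split=> [|d dT].
      have HE : H = \sum_i w 0 i *: ('i%C *: Hd ss`_i : realif g) by [].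
      rewrite HE; apply: rpred_sum => i _; apply: rpredZ.
      by apply/memv_span/mapP; exists ss`_i => //; exact: ssR.
    have dlt : (index d rs < size rs)%N by rewrite index_mem.
    rewrite -[LHS]/(ev d H) evH ?Rtheta_root //.
    move/rowP/(_ (Ordinal dlt)): wA; rewrite !mxE => wd.
    set S := \sum_(_ < _) _; suff -> : S = 0 by rewrite rmorph0 mulr0.
    by rewrite -[RHS]wd; apply: eq_bigr => i _; rewrite mxE /= nth_index.
  have := ktab _ Ht; rewrite !evH // => /(mulfI (i_neq0 R))/complexI E.
  apply/matrixP=> i j; rewrite !ord1 !mxE.
  under eq_bigr => k _ do rewrite mxE mulrBr.
  by rewrite sumrB E subrr.
pose dl := a - b - \sum_j (D j 0)%:C%C *: rs`_j.
suff dl0 : dl = 0.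
  have -> : a - b = \sum_j (D j 0)%:C%C *: rs`_j by exact: subr0_eq.
  by apply: rpred_sum => j _; rewrite rpredZ // (Rtheta_span (rsT j)).
(* [Hl] represents [dl] through B. The matrix identity says that [dl] vanishes at each H_e, that is,
   each root e vanishes at [Hl]; hence [Hl] is 0. *)
pose Hl := Hd a - Hd b - \sum_j (D j 0)%:C%C *: Hd rs`_j.
have Hlh : Hl \in h.
  apply: rpredB; first by apply: rpredB; exact: Hd_h.
  by apply: rpred_sum => j _; apply: rpredZ; exact: Hd_h.
have dlE H : H \in h -> ev dl H = killing H Hl.
  move=> Hh; rewrite !evBl ev_suml !linearB /= !ev_killing //; congr (_ - _).
  rewrite linear_sum; apply: eq_bigr => j _ /=.
  by rewrite evZl killingZr ev_killing.
suff Hl0 : Hl = 0 by apply: ev_eq0 => H Hh; rewrite dlE // Hl0 linear0.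
apply: root_separating => // e eR; rewrite ev_killing // killingC -dlE //.
have elt : (index e ss < size ss)%N by rewrite index_mem.
move/colP/(_ (Ordinal elt)): cD; rewrite !mxE /= nth_index //.
move/(congr1 (real_complex R)); rewrite rmorphB /= !RRe_real ?ev_Hd_real // => E.
rewrite !evBl E ev_suml rmorph_sum -sumrB big1 // => j _.
rewrite mxE /= nth_index // evZl rmorphM /= RRe_real ?ev_Hd_real //.
by rewrite mulrC subrr.
Qed.

(** An expansion over [theta], padded by zeros, is also one over [simple]; freeness of the simple
    roots identifies it with [c]. *)
Lemma simple_coef_theta (c : dual h -> C) :
    \sum_(s <- simple F) c s *: s \in <<theta F>>%VS ->
  forall s, s \in simple F -> s \notin theta F -> c s = 0.
Proof.
move=> cT s sS sT.
have sF := simple_free F.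
have tE : [seq t <- simple F | t \in theta F] =i (theta F : seq _).
  move=> t; rewrite mem_filter; apply/andP/idP => [[]//|tT].
  by split=> //; exact: (fsubsetP (theta_sub F)).
move: cT; rewrite -(eq_span tE) => /(free_span (filter_free _ sF))[k kE _].
have sSpan : \sum_(s <- simple F) c s *: s \in <<simple F>>%VS.
  by rewrite big_seq rpred_sum // => t tS; rewrite rpredZ // memv_span.
have [k' _ k'u] := free_span sF sSpan.
rewrite (k'u c) // -(k'u (fun t => if t \in theta F then k t else 0)) //.
  by rewrite (negPf sT).
rewrite kE big_filter big_mkcond; apply: eq_bigr => t _.
by case: ifP => //; rewrite scale0r.
Qed.

Lemma root_simple_comb a : a \in Rt ->
  exists n : dual h -> int, a = \sum_(s <- simple F) s *~ n s.
Proof.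
case/simpleP => [[c aE]|[c aE]].
  by exists (fun s => (c s)%:Z); rewrite aE; apply: eq_bigr.
exists (fun s => - (c s)%:Z); rewrite -[LHS]opprK aE -sumrN.
by apply: eq_bigr => s _; rewrite mulrNz.
Qed.

Lemma intmul_absz (V : zmodType) (x : V) (n : int) :
  x *~ n = (if 0 <= n then x else - x) *+ `|n|%N.
Proof. by case: n => k //=; rewrite NegzE mulrNz mulNrn pmulrn. Qed.

(** Roots have integer coordinates in the simple roots, and those of [a - b] outside [theta] vanish.
    Repeating each remaining simple root, or its opposite, as often as the absolute value of its
    coordinate gives a list, whose length can serve for induction. *)
Lemma theta_sum a b : a \in Rt -> b \in Rt -> a - b \in <<theta F>>%VS ->
  exists2 ts : seq (dual h), {subset ts <= Rtheta} & a = b + \sum_(t <- ts) t.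
Proof.
move=> /root_simple_comb[m aE] /root_simple_comb[n bE] abT.
pose p s := m s - n s.
have abE : a - b = \sum_(s <- simple F) s *~ p s.
  by rewrite aE bE -sumrB; apply: eq_bigr => s _; rewrite mulrzBr.
have p0 s : s \in simple F -> s \notin theta F -> p s = 0.
  move=> sS sT; apply/eqP; rewrite -(intr_eq0 C); apply/eqP.
  apply: (simple_coef_theta (c := fun s => (p s)%:~R)) sS sT.
  by under eq_bigr do rewrite scaler_int; rewrite -abE.
pose e s : seq (dual h) := nseq `|p s|%N (if 0 <= p s then s else - s).
exists (flatten [seq e s | s <- simple F]) => [t /flatten_mapP[s sS]|].
  rewrite mem_nseq absz_gt0 => /andP[ps /eqP->].
  have sT : s \in theta F by apply: contraNT ps => sT; rewrite p0.
  have sTh : s \in Rtheta.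
    rewrite mem_Rtheta memv_span // andbT; exact: (fsubsetP (simple_sub F)).
  by case: ifP => // _; exact: RthetaN.
apply/eqP; rewrite addrC -subr_eq abE; apply/eqP.
rewrite big_flatten big_map; apply: eq_bigr => s _ /=.
by rewrite big_nseq iter_addr_0 intmul_absz.
Qed.

(** Induction on the length of [ts]. Either endpoint may move: [t] is subtracted from [a] or added
    to [b], and in both cases it leaves the list. The moved endpoint stays in R_M because [t] lies
    in the span of Theta. *)
Lemma theta_chain (T : Type) (f : dual h -> T) :
    (forall a b, a \in RM -> b \in Rtheta -> a + b \in Rt -> f (a + b) = f a) ->
  forall ts a b, a \in RM -> b \in RM -> {subset ts <= Rtheta} ->
    a = b + \sum_(t <- ts) t -> f a = f b.
Proof.
move=> fE ts; have [n] := ubnP (size ts); elim: n => // n IHn in ts * => lt_ts.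
move=> a b aM bM tsT abE.
have [->//|nab] := eqVneq a b.
have aR := RM_root aM; have bR := RM_root bM.
have tR t : t \in ts -> t \in Rt by move=> /tsT/Rtheta_root.
(* [gm] need not be a root, so [Hd gm] carries no information; the vector representing [gm] through
   B is built from the summands. *)
pose gm := a - b; pose H := \sum_(t <- ts) Hd t.
have gmE : gm = \sum_(t <- ts) t by rewrite /gm abE addrC addKr.
have Hh : H \in h by apply: rpred_sum => t _; exact: Hd_h.
have gm_killing H' : H' \in h -> ev gm H' = killing H' H.
  move=> H'h; rewrite gmE ev_suml linear_sum /=; apply: eq_big_seq => t /tR tt.
  exact: ev_killing.
have H0 : H != 0.
  apply: contraNneq nab => H0; rewrite -subr_eq0; apply/eqP/ev_eq0 => H' H'h.
  by rewrite -/gm gm_killing // H0 linear0.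
have gmR t : t \in ts -> ev gm (Hd t) \is Num.real.
  by move=> /tR tt; rewrite evBl rpredB // ev_Hd_real.
have [t tts gt0] : exists2 t, t \in ts & 0 < ev gm (Hd t).
  apply: contrapT => nt; have : 0 < killing H H.
    apply: killing_gt0 => // c cR; rewrite linear_sum big_seq rpred_sum //= => t tts.
    by apply: ev_Hd_real => //; exact: tR.
  rewrite -gm_killing // linear_sum /= big_seq real_ltNge ?rpred0 ?rpred_sum //.
  rewrite sumr_le0 // => t tts; rewrite real_leNgt ?gmR ?rpred0 //.
  by apply/negP => gt0; case: nt; exists t.
have tT := tsT t tts; have NtT := RthetaN tT; have tRt := tR t tts.
have lt_rem : (size (rem t ts) < n)%N.
  rewrite size_rem //.
  by case: ts tts lt_ts {tsT abE tR H gmE Hh gm_killing H0 gmR}.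
have remT : {subset rem t ts <= Rtheta} by move=> u /mem_rem/tsT.
rewrite (big_rem t) //= in abE.
have [at_gt0|at_le0] := boolP (0 < ev a (Hd t)).
  have aNt : a - t \in Rt.
    have [? ?] := RM_neq_theta aM NtT.
    rewrite addrC addr_root // ?root_opp //.
    by rewrite ev_HdC ?root_opp // evNl oppr_lt0 ev_HdC.
  rewrite -(fE a (- t)) //; apply: IHn lt_rem _ _ _ bM remT _; first exact: RM_add.
  by rewrite abE addrCA addrAC subrr add0r.
have bt : b + t \in Rt.
  have [? ?] := RM_neq_theta bM tT.
  rewrite addrC addr_root //.
  rewrite real_ltNge ?ev_Hd_real ?rpred0 //; apply: contra at_le0 => bt_ge0.
  by move: gt0; rewrite evBl subr_gt0; exact: le_lt_trans.
rewrite -(fE b t) //; apply: IHn lt_rem _ _ aM _ remT _; first exact: RM_add.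
by rewrite abE addrA.
Qed.

Lemma kt_chain (T : Type) (f : dual h -> T) :
    (forall a b, a \in RM -> b \in Rtheta -> a + b \in Rt -> f (a + b) = f a) ->
  forall a b, a \in RM -> b \in RM -> kt a = kt b -> f a = f b.
Proof.
move=> fE a b aM bM kab; have [aR bR] := (RM_root aM, RM_root bM).
have [ts tsT abE] := theta_sum aR bR (kt_span aR bR kab).
exact: (theta_chain fE) tsT abE.
Qed.

Local Notation RMp := (pos_roots_M F).

Lemma mem_RMp a : (a \in RMp) = (a \in RM) && `[< nat_comb (simple F) a >].
Proof.
rewrite in_fsetI; case aM: (a \in RM) => //=.
by rewrite !inE /= RM_root.
Qed.

Lemma RM_pos a : a \in RM -> (a \in RMp) || (- a \in RMp).
Proof.
move=> aM; rewrite !mem_RMp aM RMN //=.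
by case: (simpleP (RM_root aM)) => [/asboolP->//|/asboolP->]; rewrite orbT.
Qed.

Lemma RMp_sub a : a \in RMp -> a \in RM.
Proof. by rewrite mem_RMp => /andP[]. Qed.

(** Otherwise [a + b] would lie in the span of Theta. Its coordinates outside [theta] are sums of
    natural numbers, so those of [a] would vanish and [a] would lie in that span too. This makes
    positive and negative t-roots disjoint, so that signs on the positive ones are free. *)
Lemma kt_posN a b : a \in RMp -> b \in RMp -> kt a <> - kt b.
Proof.
move=> aP bP; rewrite -ktN => kab.
have [/RMp_sub aM /RMp_sub bM] := (aP, bP).
have := kt_span (RM_root aM) (root_opp (RM_root bM)) kab; rewrite opprK => abT.
move: aP bP; rewrite !mem_RMp => /andP[_ /asboolP[m aE]] /andP[_ /asboolP[n bE]].
have mn0 s : s \in simple F -> s \notin theta F -> m s = 0%N.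
  move=> sS sT; apply/eqP; rewrite -leqn0 (leq_trans (leq_addr (n s) _)) // leqn0.
  rewrite -(pnatr_eq0 C); apply/eqP.
  apply: (simple_coef_theta (c := fun s => (m s + n s)%:R)) sS sT.
  under eq_bigr do rewrite scaler_nat mulrnDr.
  by rewrite big_split /= -aE -bE.
move: aM; rewrite mem_RM => /andP[_ /negP]; apply.
rewrite aE big_seq rpred_sum // => s sS.
have [sT|sT] := boolP (s \in theta F); last by rewrite mn0 // mulr0n mem0v.
by rewrite rpredMn // memv_span.
Qed.

(** * Isotropy-invariant operators *)

Local Notation gR := (realif g).
Local Notation m := (m_ F).

Lemma eq_opp0 (V : lmodType C) (v : V) : v = - v -> v = 0.
Proof.
move/eqP; rewrite -addr_eq0 -mulr2n -scaler_nat scaler_eq0 pnatr_eq0.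
by move/eqP.
Qed.

Lemma root_neqN a : a \in Rt -> a != - a.
Proof. by move=> /root_neq0; apply: contraNneq => /eq_opp0->. Qed.

(* The elements of [u_ a] are the [u_vec z a] with [z] complex, and
   multiplication by ['i] on [z] is the complex structure of [u_ a]. *)
Definition u_vec (z : C) a : g := z *: X a - z^*%C *: X (- a).

Lemma u_vecD z z' a : u_vec (z + z') a = u_vec z a + u_vec z' a.
Proof. by rewrite /u_vec conjcD !scalerDl opprD addrACA. Qed.

Lemma u_vec0 a : u_vec 0 a = 0.
Proof. by rewrite /u_vec rmorph0 !scale0r subr0. Qed.

Lemma u_vecZ (r : R) z a : r%:C%C *: u_vec z a = u_vec (r%:C%C * z) a.
Proof. by rewrite /u_vec conjcM conjc_real scalerBr !scalerA. Qed.

(** Since u_a = u_{-a}, this lets later statements range over all of R_M without regard to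
    positivity. *)
Lemma u_vecN z a : u_vec z (- a) = u_vec (- z^*%C) a.
Proof. by rewrite /u_vec opprK conjcN conjcK !scaleNr opprK addrC. Qed.

Lemma mem_u a (x : gR) : x \in u_ a <-> exists z, x = u_vec z a.
Proof.
have E (r s : R) : u_vec (r +i* s)%C a =
    r *: (X a - X (- a) : gR) + s *: ('i%C *: (X a + X (- a)) : gR).
  rewrite /u_vec [(r +i* s)%C]complexE conjcD conjcM conjci !conjc_real /=.
  rewrite -[RHS]/(r%:C%C *: (X a - X (- a)) +
    s%:C%C *: ('i%C *: (X a + X (- a))) : g).
  rewrite scalerA [s%:C%C * _]mulrC !scalerDr scalerN !scalerDl mulNr scaleNr.
  by rewrite opprD opprK addrACA.
split=> [|[[r s] ->]].
  rewrite /u_ span_cons span_seq1 => /memv_addP[_ /vlineP[r ->] [_ /vlineP[s ->] ->]].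
  by exists (r +i* s)%C; rewrite E.
by rewrite E rpredD // rpredZ // memv_span // !inE eqxx ?orbT.
Qed.

Lemma u_vec_m a z : a \in RM -> (u_vec z a : gR) \in m.
Proof.
move=> aM; wlog aP : a z aM / a \in RMp.
  move=> IH; have /orP[aP|aP] := RM_pos aM; first exact: IH.
  by rewrite -[a]opprK u_vecN; apply: IH => //; apply: RMN.
rewrite /m_ (big_fsetD1 a aP) /=; apply: (subvP (addvSl _ _)).
by apply/mem_u; exists z.
Qed.

Lemma u_vec_k b z : b \in Rtheta -> (u_vec z b : gR) \in k_theta F.
Proof.
move=> bT; wlog bP : b z bT / b \in pos_roots_theta F.
  move=> IH; have bR := Rtheta_root bT.
  have pos c : c \in Rtheta -> nat_comb (simple F) c -> c \in pos_roots_theta F.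
    move=> cT cS; rewrite in_fsetI cT !inE /= Rtheta_root //=; exact/asboolP.
  case: (simpleP bR) => bS; first by apply: IH => //; exact: pos.
  have NbT := RthetaN bT.
  by rewrite -[b]opprK u_vecN; apply: IH => //; exact: pos.
rewrite /k_theta (big_fsetD1 b bP) /=.
apply: (subvP (addvSr _ _)); apply: (subvP (addvSl _ _)).
by apply/mem_u; exists z.
Qed.

Lemma m_ind (P : g -> Prop) : (forall u v, P u -> P v -> P (u + v)) ->
  (forall a z, a \in RM -> P (u_vec z a)) -> P 0 ->
  forall x : gR, x \in m -> P x.
Proof.
move=> PD Pwv P0 x; apply: sumv_seqP => // a u aP /mem_u[z ->].
exact/Pwv/RMp_sub.
Qed.

Lemma k_ind (P : g -> Prop) : (forall u v, P u -> P v -> P (u + v)) ->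
  (forall c (r : R), c \in Rt -> P (r%:C%C *: ('i%C *: Hd c))) ->
  (forall b z, b \in Rtheta -> P (u_vec z b)) -> P 0 ->
  forall x : gR, x \in k_theta F -> P x.
Proof.
move=> PD PH Pwv P0 x /memv_addP[u uH [v vT ->]]; apply: (PD).
  move: uH; rewrite /ihR span_def big_map; apply: sumv_seqP => // c w cR /vlineP[r ->].
  exact: PH.
apply: sumv_seqP vT => // b w; rewrite in_fsetI => /andP[bT _] /mem_u[z ->].
exact: Pwv.
Qed.

(** Reality of a(H_c) makes the coefficients at X_a and X_{-a} conjugate as required, so the result
    is again in u_a. *)
Lemma lie_iH_u_vec c a z : c \in Rt -> a \in Rt ->
  lie ('i%C *: Hd c) (u_vec z a) = u_vec ('i%C * ev a (Hd c) * z) a.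
Proof.
move=> cR aR; have cH := Hd_h c; have NaR := root_opp aR.
rewrite /u_vec linearB /= !lieZr !lieZl !lie_hX // evNl !conjcM conjci.
have -> : (ev a (Hd c))^*%C = ev a (Hd c).
  by rewrite -(RRe_real (ev_Hd_real cR aR)) conjc_real.
by rewrite !scalerA; congr (_ *: _ - _ *: _); ring.
Qed.

(** [weyl_coefN] pairs the four brackets into two vectors of the compact form. No case split is
    needed: when [b + a] or [b - a] is not a root, its structure constant is 0. *)
Lemma lie_u_vec b a (y z : C) : b \in Rtheta -> a \in RM ->
  lie (u_vec y b) (u_vec z a) =
    u_vec (y * z * (N b a)%:C%C) (b + a) +
    u_vec (- (y * z^*%C * (N b (- a))%:C%C)) (b - a).
Proof.
move=> bT aM; have bR := Rtheta_root bT; have aR := RM_root aM.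
have [NbR NaR] := (root_opp bR, root_opp aR).
have [/negPf nab /negPf naNb] := RM_neq_theta aM bT.
have ba0 : b + a != 0 by rewrite addrC addr_eq0 naNb.
have bNa0 : b - a != 0 by rewrite subr_eq0 eq_sym nab.
have Nba0 : - b + a != 0 by rewrite addrC subr_eq0 nab.
have NbNa0 : - b - a != 0 by rewrite -opprD oppr_eq0.
rewrite {1 2}/u_vec linearB /= !lieDl !lieNl !lieZr !lieZl !weyl_lie //.
rewrite (weyl_coefN bR aR) // (weyl_coefN bR NaR) // opprK /u_vec.
rewrite !conjcN !conjcM !conjcK !conjc_real !opprD !opprK.
rewrite !scalerA [z * y]mulrC [z * _]mulrC [z^*%C * y]mulrC [z^*%C * _]mulrC.
rewrite !(rmorphN, mulrN, scaleNr, opprK) /=.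
by rewrite [X in _ + X = _]addrC addrACA [X in _ + X = _]addrC.
Qed.

Lemma killing_u_vec a b z : a \in Rt -> b \in Rt ->
  killing (u_vec z a) (X (- b)) = z * (a == b)%:R - z^*%C * (- a == b)%:R.
Proof.
by move=> aR bR; rewrite killingDl killingNl !killingZl !killing_XN // root_opp.
Qed.

Lemma killing_u_vec_self a z : a \in Rt -> killing (u_vec z a) (X (- a)) = z.
Proof.
move=> aR; rewrite killing_u_vec // eqxx eq_sym (negPf (root_neqN aR)).
by rewrite mulr1 mulr0 subr0.
Qed.

Lemma u_vec_inj a z z' : a \in Rt -> u_vec z a = u_vec z' a -> z = z'.
Proof. by move=> aR E; rewrite -(killing_u_vec_self z aR) E killing_u_vec_self. Qed.

(** B(x, X_{-a}) is the coefficient of [x] at X_a; this is the reality condition that cuts the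
    compact form out of [g]. *)
Lemma m_conj (x : gR) a : x \in m -> a \in RM ->
  killing (x : g) (X a) = - (killing (x : g) (X (- a)))^*%C.
Proof.
move=> xm aM; have aR := RM_root aM; elim/m_ind: x / xm => [u v uE vE|b z bM|].
- by rewrite !killingDl uE vE conjcD opprD.
- rewrite -{1}[a]opprK !killing_u_vec ?root_opp ?RM_root //.
  rewrite conjcD conjcN !conjcM conjcK.
  by rewrite !conjc_nat eqr_opp eqr_oppLR opprB.
by rewrite !(killingC 0) !linear0.
Qed.

Lemma m_decomp (x : gR) : x \in m ->
  x = \sum_(b <- RM) killing (x : g) (X (- b)) *: X b :> g.
Proof.
elim/m_ind: x / => [u v uE vE|a z aM|].
- rewrite {1}uE {1}vE -big_split; apply: eq_bigr => b _ /=.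
  by rewrite killingDl scalerDl.
- have aR := RM_root aM; have NaM := RMN aM.
  rewrite (big_fsetD1 a) //= (big_fsetD1 (- a)) /=; last first.
    by rewrite in_fsetD1 NaM eq_sym root_neqN.
  rewrite (killing_u_vec_self z aR) (killing_u_vec z aR (root_opp aR)).
  rewrite eqxx (negPf (root_neqN aR)).
  rewrite [X in _ + (_ + X)]big1_seq => [|b /=].
    by rewrite addr0 mulr0 sub0r mulr1 scaleNr.
  rewrite in_fsetD1 => /andP[bNa]; rewrite in_fsetD1 => /andP[ba bM].
  rewrite (killing_u_vec _ aR (RM_root bM)) [a == b]eq_sym (negPf ba).
  by rewrite [- a == b]eq_sym (negPf bNa) !mulr0 subr0 scale0r.
by rewrite big1 // => b _; rewrite killingC linear0 scale0r.
Qed.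

(** * Operators on m that are diagonal on the root vectors *)

Definition m_fun (J : 'End(subvs_of m)) (x : gR) : gR := vsval (J (vsproj m x)).

Lemma m_fun_is_linear J : linear (m_fun J).
Proof. by move=> r x y; rewrite /m_fun !linearP. Qed.
HB.instance Definition _ J :=
  GRing.isLinear.Build R gR gR *:%R (m_fun J) (m_fun_is_linear J).

Lemma m_funD J (u v : g) : m_fun J (u + v) = m_fun J u + m_fun J v :> g.
Proof. exact: (linearD (m_fun J)). Qed.
Lemma m_funZ J (r : R) (u : g) : m_fun J (r%:C%C *: u) = r%:C%C *: m_fun J u :> g.
Proof. by rewrite -[LHS]/(m_fun J (r *: (u : gR))) linearZ. Qed.
Lemma m_funN J (u : g) : m_fun J (- u) = - m_fun J u :> g.
Proof. exact: (linearN (m_fun J)). Qed.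
Lemma m_fun0 J : m_fun J 0 = 0 :> g.
Proof. exact: (linear0 (m_fun J)). Qed.

(** The eigenvector equation J X_a = lam(a) X_a, expressed on the real vectors of m before any
    complexification. *)
Definition has_weights (J : 'End(subvs_of m)) (lam : dual h -> C) :=
  forall a z, a \in RM -> m_fun J (u_vec z a) = u_vec (lam a * z) a.

Lemma m_fun_m J x : m_fun J x \in m. Proof. exact: subvsP. Qed.

Lemma weights_eq J J' lam lam' :
  has_weights J lam -> has_weights J' lam' -> {in RM, lam =1 lam'} -> J = J'.
Proof.
move=> HJ HJ' E; suff Jm : forall x : gR, x \in m -> m_fun J x = m_fun J' x.
  apply/lfunP => x; apply: val_inj; have := Jm _ (subvsP x).
  by rewrite /m_fun vsvalK.
apply: m_ind => [u v uE vE|a z aM|]; last by rewrite !m_fun0.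
  by rewrite !m_funD uE vE.
by rewrite HJ // HJ' // E.
Qed.

Lemma Hd_separates a b : a \in Rt -> b \in Rt ->
  (forall c, c \in Rt -> ev a (Hd c) = ev b (Hd c)) -> a = b.
Proof.
move=> aR bR ab; have E : Hd a = Hd b.
  apply: subr0_eq; apply: root_separating => [|c cR].
    by apply: rpredB; exact: Hd_h.
  by rewrite linearB /= ev_HdC // ab // [ev c _]ev_HdC // subrr.
by apply: subr0_eq; apply: ev_eq0 => H Hh; rewrite evBl !ev_killing // E subrr.
Qed.

Definition real_lfun (f : 'End(g)) (x : gR) : gR := f x.
Lemma real_lfun_is_linear f : linear (real_lfun f).
Proof. by move=> r x y; exact: (linearP f). Qed.
HB.instance Definition _ f :=
  GRing.isLinear.Build R gR gR *:%R (real_lfun f) (real_lfun_is_linear f).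

(** Extended by 0 on [h] and on the root vectors of R_Theta. Being complex-linear on all of [g], it
    yields both the real operator on m and its complex extension. *)
Definition weight_op (lam : dual h -> C) : 'End(g) :=
  \sum_(b <- RM) lam b *: linfun (rank1 (X (- b)) (X b)).

Lemma weight_op_X lam a : a \in RM -> weight_op lam (X a) = lam a *: X a.
Proof.
move=> aM; have aR := RM_root aM.
have E b : (lam b *: linfun (rank1 (X (- b)) (X b)) : 'End(g)) (X a) =
    lam b *: (killing (X a) (X (- b)) *: X b).
  by rewrite scale_lfunE lfunE /= /rank1 killingC.
rewrite /weight_op sum_lfunE (eq_bigr _ (fun b _ => E b)) (big_fsetD1 a aM) /=.
rewrite weyl_killing // scale1r [X in _ + X]big1_seq => [|b /=].
  by rewrite addr0.
rewrite in_fsetD1 => /andP[nba bM].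
by rewrite (killing_XN aR (RM_root bM)) eq_sym (negPf nba) scale0r scaler0.
Qed.

(** The condition under which [weight_op lam] preserves the real space m. *)
Definition conj_weights (lam : dual h -> C) :=
  forall a, a \in RM -> lam (- a) = (lam a)^*%C.
Definition theta_invariant (lam : dual h -> C) :=
  forall a b, a \in RM -> b \in Rtheta -> a + b \in Rt -> lam (a + b) = lam a.

Lemma weight_op_u_vec lam a z : conj_weights lam -> a \in RM ->
  weight_op lam (u_vec z a) = u_vec (lam a * z) a.
Proof.
move=> lamc aM; have NaM := RMN aM.
rewrite linearB /= !linearZ /= !weight_op_X // lamc // !scalerA /u_vec conjcM.
by rewrite scalerN scalerA; congr (_ *: _ - _ *: _); exact: mulrC.
Qed.

Lemma weights_exist lam : conj_weights lam -> exists J, has_weights J lam.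
Proof.
move=> lamc.
exists (linfun (vsproj m) \o (linfun (real_lfun (weight_op lam)) \o linfun vsval))%VF.
move=> a z aM; rewrite /m_fun !comp_lfunE !lfunE /= (vsprojK (u_vec_m _ aM)) //.
rewrite -[real_lfun _ _]/(weight_op lam (u_vec z a)) weight_op_u_vec //.
by rewrite (vsprojK (u_vec_m _ aM)).
Qed.

Lemma weights_acs J lam : has_weights J lam -> {in RM, forall a, lam a * lam a = -1} ->
  (J \o J)%VF = - \1%VF.
Proof.
move=> HJ lam2; suff JJ : forall x : gR, x \in m -> m_fun J (m_fun J x) = - x.
  apply/lfunP=> x; rewrite comp_lfunE opp_lfunE id_lfunE; apply: val_inj.
  by have := JJ _ (subvsP x); rewrite /m_fun !vsvalK.
apply: m_ind => [u v uE vE|a z aM|].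
- by rewrite !m_funD uE vE opprD.
- by rewrite !HJ // mulrA lam2 // mulN1r /u_vec conjcN !scaleNr -opprD.
by rewrite !m_fun0 oppr0.
Qed.

(** The factor n_{b,a} is kept inside the argument because it vanishes when [b + a] is not a root,
    the case about which [has_weights] says nothing. *)
Lemma weights_bracket J lam a b z : has_weights J lam -> theta_invariant lam ->
  a \in RM -> b \in Rtheta ->
  m_fun J (u_vec (z * (N b a)%:C%C) (b + a)) =
    u_vec (lam a * (z * (N b a)%:C%C)) (b + a).
Proof.
move=> HJ lamT aM bT; have [aR bR] := (RM_root aM, Rtheta_root bT).
have [nab naNb] := RM_neq_theta aM bT.
have ba0 : b + a != 0 by rewrite addrC addr_eq0 naNb.
have [baR|baR] := boolP (b + a \in Rt).
  by rewrite addrC in baR *; rewrite HJ ?RM_add // lamT.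
by rewrite (weyl_coef_eq0 bR aR ba0 baR) !mulr0 u_vec0 m_fun0.
Qed.

Lemma weights_invariant J lam : has_weights J lam ->
    {in RM, forall a, lam a * lam a = -1} -> conj_weights lam ->
    theta_invariant lam ->
  invariant_acs J.
Proof.
move=> HJ lam2 lamc lamT; split; first exact: weights_acs lam2.
move=> L x Lk; rewrite -/(m_fun J (lie (L : g) (vsval x))).
have -> : vsval (J x) = m_fun J (vsval x) by rewrite /m_fun vsvalK.
move: (vsval x : gR) (subvsP x) => {}x xm.
elim/k_ind: L / Lk => [u v uE vE|c r cR|b y bT|].
- by rewrite !lieDl uE vE m_funD.
- elim/m_ind: x / xm => [u v uE vE|a z aM|].
  + by rewrite m_funD !linearD /= uE vE.
  + have aR := RM_root aM.
    rewrite HJ // !(lieZl r%:C%C) !lie_iH_u_vec // !u_vecZ HJ //.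
    by congr (u_vec _ _); ring.
  + by rewrite m_fun0 !linear0.
- elim/m_ind: x / xm => [u v uE vE|a z aM|].
  + by rewrite m_funD !linearD /= uE vE.
  + have NaM := RMN aM.
    rewrite HJ // !lie_u_vec // m_funD -mulNr -(mulNr (y * z^*%C)).
    (* The component at [b - a] involves the conjugate of lam(a) on one side and lam(-a) on the
       other; [lamc] identifies them. *)
    rewrite !(weights_bracket _ HJ) // lamc // conjcM.
    congr (_ + _); congr (u_vec _ _); ring.
  + by rewrite m_fun0 !linear0.
by rewrite !lie0l m_fun0.
Qed.

(** For the coefficient q_b at X_b, the numbers q_b(i) - i q_b(1) and q_b(i) + i q_b(1) measure the
    antilinear and the complex-linear part. Commutation with ad(i H_c) shows that (b + a)(H_c) kills
    the first and (b - a)(H_c) the second, for all c, and the H_c separate roots. *)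
Lemma m_fun_coef (J : 'End(subvs_of m)) a : invariant_acs J -> a \in RM -> forall z,
  killing (m_fun J (u_vec z a) : g) (X (- a)) =
    z * killing (m_fun J (u_vec 1 a) : g) (X (- a)) /\
  {in RM, forall b, b != a -> b != - a ->
    killing (m_fun J (u_vec z a) : g) (X (- b)) = 0}.
Proof.
move=> [_ Jinv] aM; have aR := RM_root aM.
pose q b z : C := killing (m_fun J (u_vec z a) : g) (X (- b)).
have qD b (r s : R) : q b (r +i* s)%C = r%:C%C * q b 1 + s%:C%C * q b 'i%C.
  rewrite /q -!killingZl -killingDl; congr killing.
  rewrite [(r +i* s)%C]complexE /= u_vecD ['i%C * _]mulrC -u_vecZ.
  rewrite -[in LHS](mulr1 r%:C%C) -u_vecZ.
  by rewrite m_funD !m_funZ.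
have qi b c z : b \in RM -> c \in Rt ->
    'i%C * ev b (Hd c) * q b z = ev a (Hd c) * q b ('i%C * z).
  move=> bM cR; have bR := RM_root bM.
  have ck : ('i%C *: Hd c : gR) \in k_theta F.
    apply: (subvP (addvSl _ _)); apply: memv_span; exact/mapP/(ex_intro2 _ _ c).
  have := Jinv _ (vsproj m (u_vec z a)) ck.
  rewrite -/(m_fun J (u_vec z a)) vsprojK ?u_vec_m //.
  rewrite lie_iH_u_vec // -/(m_fun J _) => /(congr1 (fun u : g => killing u (X (- b)))).
  rewrite lieC killingNl killing_lie lieZl lie_hX ?root_opp //.
  rewrite evNl !killingZr mulNr mulrN opprK mulrA => ->.
  rewrite -(RRe_real (ev_Hd_real cR aR)) [_ * _%:C%C]mulrC -mulrA -u_vecZ.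
  by rewrite m_funZ -killingZl.
have q1 b c : b \in RM -> c \in Rt ->
    'i%C * ev b (Hd c) * q b 1 = ev a (Hd c) * q b 'i%C.
  by move=> bM cR; rewrite qi // mulr1.
have ii := mulcii R.
have q2 b c : b \in RM -> c \in Rt ->
    'i%C * ev b (Hd c) * q b 'i%C = - ev a (Hd c) * q b 1.
  move=> bM cR; rewrite qi // ii.
  rewrite /q; have -> : u_vec (-1) a = - u_vec 1 a.
    by rewrite /u_vec conjcN !scaleNr opprD opprK.
  by rewrite m_funN killingNl mulrN mulNr.
have qs b : b \in RM -> b != - a -> q b 'i%C = 'i%C * q b 1.
  move=> bM bNa; have bR := RM_root bM; apply/eqP; rewrite -subr_eq0.
  apply: contraNT bNa => s0; apply/eqP/Hd_separates => //; first exact: root_opp.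
  move=> c cR; rewrite evNl; apply/eqP; rewrite -addr_eq0; apply/eqP/(mulIf s0).
  rewrite mul0r.
  (* Arranged so that [q1] cancels the bracket, while [q2] turns the rest into a multiple of 1 +
     i^2. *)
  have -> : (ev b (Hd c) + ev a (Hd c)) * (q b 'i%C - 'i%C * q b 1) =
    (ev a (Hd c) * q b 'i%C - 'i%C * ev b (Hd c) * q b 1)
      + ev b (Hd c) * q b 'i%C - 'i%C * (ev a (Hd c) * q b 1) by ring.
  rewrite q1 // subrr add0r.
  have -> : ev a (Hd c) * q b 1 = - ('i%C * ev b (Hd c) * q b 'i%C).
    by rewrite q2 // mulNr opprK.
  have -> : ev b (Hd c) * q b 'i%C - 'i%C * - ('i%C * ev b (Hd c) * q b 'i%C) =
     (1 + 'i%C * 'i%C) * (ev b (Hd c) * q b 'i%C) by ring.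
  by rewrite ii subrr mul0r.
have qt b : b \in RM -> b != a -> q b 'i%C = - ('i%C * q b 1).
  move=> bM ba; have bR := RM_root bM; apply/eqP; rewrite -addr_eq0.
  apply: contraNT ba => s0; apply/eqP/Hd_separates => //.
  move=> c cR; apply/eqP; rewrite -subr_eq0; apply/eqP/(mulIf s0).
  rewrite mul0r.
  have -> : (ev b (Hd c) - ev a (Hd c)) * (q b 'i%C + 'i%C * q b 1) =
    ('i%C * ev b (Hd c) * q b 1 - ev a (Hd c) * q b 'i%C)
      + ev b (Hd c) * q b 'i%C - 'i%C * (ev a (Hd c) * q b 1) by ring.
  rewrite q1 // subrr add0r.
  have -> : ev a (Hd c) * q b 1 = - ('i%C * ev b (Hd c) * q b 'i%C).
    by rewrite q2 // mulNr opprK.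
  have -> : ev b (Hd c) * q b 'i%C - 'i%C * - ('i%C * ev b (Hd c) * q b 'i%C) =
     (1 + 'i%C * 'i%C) * (ev b (Hd c) * q b 'i%C) by ring.
  by rewrite ii subrr mul0r.
move=> [r s]; split=> [|b bM ba bNa].
  rewrite -/(q a _) -/(q a _) qD (qs a) // ?root_neqN //.
  rewrite [(r +i* s)%C in RHS]complexE.
  ring.
rewrite -/(q b _) qD.
have qb0 : q b 1 = 0.
  have : 'i%C * q b 1 = - ('i%C * q b 1) by rewrite -qt // qs.
  move/eqP; rewrite -addr_eq0 -mulr2n -mulr_natl mulf_eq0 pnatr_eq0 /=.
  by rewrite mulf_eq0 complexiE (negPf (neq0Ci _)) => /eqP.
by rewrite (qs b) // qb0 !mulr0 addr0.
Qed.

Lemma invariant_weights (J : 'End(subvs_of m)) : invariant_acs J -> exists lam,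
  [/\ has_weights J lam, {in RM, forall a, lam a * lam a = -1}, conj_weights lam &
      theta_invariant lam].
Proof.
move=> Jinv; pose lam a := killing (m_fun J (u_vec 1 a) : g) (X (- a)).
have HJ : has_weights J lam.
  move=> a z aM; have aR := RM_root aM; have NaM := RMN aM.
  have [q0 qb] := m_fun_coef Jinv aM z.
  have wm : m_fun J (u_vec z a) \in m by exact: subvsP.
  rewrite [LHS](m_decomp wm).
  rewrite (big_fsetD1 a) //= (big_fsetD1 (- a)) /=; last first.
    by rewrite in_fsetD1 NaM eq_sym root_neqN.
  rewrite [X in _ + (_ + X)]big1_seq => [|b /=]; last first.
    rewrite in_fsetD1 => /andP[bNa]; rewrite in_fsetD1 => /andP[ba bM].
    by rewrite (qb b bM ba bNa) scale0r.
  rewrite addr0 opprK (m_conj wm aM) q0 scaleNr.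
  by rewrite /u_vec [z * _]mulrC.
have lamc : conj_weights lam.
  move=> a aM; have aR := RM_root aM; have NaM := RMN aM.
  have := HJ _ 1 NaM; rewrite u_vecN HJ // u_vecN conjc1 mulr1 => /(u_vec_inj aR).
  by rewrite mulrN mulr1 => /oppr_inj->; rewrite conjcK.
exists lam; split=> // [a aM|a b aM bT abR].
  have [JJ _] := Jinv; have aR := RM_root aM.
  have : m_fun J (m_fun J (u_vec 1 a)) = - u_vec 1 a.
    rewrite {1}/m_fun [m_fun J _]/m_fun vsvalK -comp_lfunE JJ opp_lfunE id_lfunE.
    by rewrite linearN /= vsprojK ?u_vec_m.
  rewrite !HJ // mulr1 => E; apply: (u_vec_inj aR); rewrite E.
  by rewrite /u_vec conjcN !scaleNr opprD opprK.
have [aR bR] := (RM_root aM, Rtheta_root bT); have NaM := RMN aM.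
have NaR := root_opp aR.
have [_ Jk] := Jinv.
(* Compare coefficients at X_{a+b} in [L, J x] = J [L, x]. The component in u_{b-a} contributes
   nothing ([E], [EJ]), because b - a = a + b or a - b = a + b would make [a] or [b] its own
   opposite. What remains is lam(a) n_{b,a} = lam(a+b) n_{b,a}. *)
have := Jk _ (vsproj m (u_vec 1 a)) (u_vec_k 1 bT).
rewrite -/(m_fun J (u_vec 1 a)) vsprojK ?u_vec_m // HJ // -/(m_fun J _) !lie_u_vec //.
rewrite m_funD => /(congr1 (fun u : g => killing u (X (- (b + a))))).
have abM := RM_add aM bT abR.
rewrite (killingDl (u_vec _ _)) (killingDl (m_fun _ _)) [b + a]addrC.
have [nab naNb] := RM_neq_theta aM bT.
have bNa0 : b - a != 0 by rewrite subr_eq0 eq_sym nab.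
have E (y : C) : killing (u_vec (y * (N b (- a))%:C%C) (b - a)) (X (- (a + b))) = 0.
  have [baR|baR] := boolP (b - a \in Rt); last first.
    by rewrite (weyl_coef_eq0 bR NaR bNa0 baR) mulr0 u_vec0 killingC linear0.
  rewrite (killing_u_vec _ baR abR).
  have /negPf -> : b - a != a + b.
    apply: contraNneq (root_neqN aR) => E; rewrite eq_sym.
    by apply/eqP/(addIr b); rewrite addrC.
  have /negPf -> : - (b - a) != a + b.
    apply: contraNneq (root_neqN bR) => E; rewrite eq_sym.
    by apply/eqP/(addrI a); rewrite -E opprB.
  by rewrite !mulr0 subrr.
have EJ (y : C) :
    killing (m_fun J (u_vec (y * (N b (- a))%:C%C) (b - a)) : g) (X (- (a + b))) = 0.
  have [baR|baR] := boolP (b - a \in Rt); last first.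
    by rewrite (weyl_coef_eq0 bR NaR bNa0 baR) mulr0 u_vec0 m_fun0 killingC linear0.
  have baM : b - a \in RM by rewrite addrC RM_add // addrC.
  by rewrite HJ // mulrA E.
have K1 (y : C) := killing_u_vec_self y abR.
have HJ1 (y : C) : m_fun J (u_vec y (a + b)) = u_vec (lam (a + b) * y) (a + b).
  exact: HJ.
have N0 : N b a != 0 by rewrite weyl_coef_neq0 // addrC ?root_neq0.
(* Unless these roots are variables, unification compares them by unfolding. *)
move: (b - a) (a + b) E EJ K1 HJ1 => d s E EJ K1 HJ1.
rewrite -!mulNr E EJ HJ1 !K1 !addr0 !mul1r !mulr1 => /eqP.
rewrite -subr_eq0 -mulrBl mulf_eq0 => /orP[|].
  by rewrite subr_eq0 eq_sym => /eqP.
by rewrite (inj_eq (@complexI R) _ 0) (negPf N0).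
Qed.

(** * Sign families *)

Implicit Types (eps : dual_t F -> R) (J : 'End(subvs_of m)).

Lemma kt_t_roots a : a \in RM -> kt a \in t_roots F.
Proof. by move=> aM; apply/imfsetP; exists a. Qed.

Lemma t_rootsP d : d \in t_roots F -> exists2 a, a \in RM & d = kt a.
Proof. by case/imfsetP => a aM ->; exists a. Qed.

Lemma pos_t_rootsP d : d \in pos_t_roots F -> exists2 a, a \in RMp & d = kt a.
Proof. by case/imfsetP => a aM ->; exists a. Qed.

Lemma pos_t_roots_sub d : d \in pos_t_roots F -> d \in t_roots F.
Proof. by case/pos_t_rootsP => a /RMp_sub/kt_t_roots aM ->. Qed.

Lemma t_roots_pos d : d \in t_roots F -> d \notin pos_t_roots F ->
  - d \in pos_t_roots F.
Proof.
case/t_rootsP => a aM -> dP.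
rewrite -(ktN a); apply/imfsetP.
exists (- a); last by [].
have /orP[aP|] := RM_pos aM; last by apply.
by case/negP: dP; apply/imfsetP; exists a.
Qed.

Lemma pos_t_rootsN d : d \in pos_t_roots F -> - d \notin pos_t_roots F.
Proof.
case/pos_t_rootsP => a aP ->; apply/negP => /pos_t_rootsP[b bP].
by move/(congr1 -%R); rewrite opprK; exact: kt_posN.
Qed.

Definition sign_wt eps a : C := 'i%C * (eps (kt a))%:C%C.

Lemma sign_wt_sq eps : sign_family eps ->
  {in RM, forall a, sign_wt eps a * sign_wt eps a = -1}.
Proof.
move=> epsS a /kt_t_roots/epsS[e1 _].
rewrite /sign_wt mulrACA mulcii -rmorphM.
by case: e1 => ->; rewrite ?mulrNN mul1r rmorph1 mulr1.
Qed.

Lemma sign_wt_conj eps : sign_family eps -> conj_weights (sign_wt eps).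
Proof.
move=> epsS a aM; have [_] := epsS _ (kt_t_roots (RMN aM)).
rewrite /sign_wt ktN opprK => ->.
by rewrite conjcM conjci conjc_real rmorphN mulrN mulNr.
Qed.

Lemma sign_wt_theta eps : theta_invariant (sign_wt eps).
Proof. by move=> a b aM bT _; rewrite /sign_wt ktD (kt_theta bT) addr0. Qed.

Lemma sign_exists eps : sign_family eps ->
  exists2 J, invariant_acs J & has_weights J (sign_wt eps).
Proof.
move=> epsS; have [J HJ] := weights_exist (sign_wt_conj epsS); exists J => //.
exact: (weights_invariant HJ (sign_wt_sq epsS) (sign_wt_conj epsS)
         (@sign_wt_theta eps)).
Qed.

Lemma invariant_sign J : invariant_acs J ->
  exists2 eps, sign_family eps & has_weights J (sign_wt eps).
Proof.
move=> /invariant_weights[lam [HJ lam2 lamc lamT]].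
(* The scalar is i or -i, so its imaginary part is the sign. It is read off at a chosen
   representative, and [kt_chain] shows that the choice does not matter; 0 is a default off the
   t-roots, where [sign_family] imposes nothing. *)
pose eps (d : dual_t F) : R :=
  if pselect (exists2 a, a \in RM & d = kt a) is left ex
  then complex.Im (lam (projT1 (cid2 ex))) else 0.
have epsE a : a \in RM -> lam a = 'i%C * (eps (kt a))%:C%C.
  move=> aM; rewrite /eps; case: pselect => [ex|[]]; last by exists a.
  case: cid2 => b bM kab /=; rewrite -(kt_chain lamT aM bM kab).
  have /eqP : lam a * lam a = 'i%C * 'i%C by rewrite lam2 // mulcii.
  by rewrite -!expr2 eqf_sqr => /orP[] /eqP -> /=;
    rewrite ?rmorphN rmorph1 ?mulrN mulr1.
have epsN a : a \in RM -> eps (- kt a) = - eps (kt a).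
  move=> aM; apply: complexI; apply: (mulfI (i_neq0 R)).
  rewrite -ktN -epsE ?RMN // lamc // epsE // conjcM conjci conjc_real.
  by rewrite rmorphN mulrN mulNr.
exists eps => [d /t_rootsP[a aM ->]|a z aM]; last by rewrite HJ // epsE.
split; last by rewrite epsN // opprK.
have /eqP : (eps (kt a))^+2 = 1.
  apply: complexI; rewrite rmorphXn rmorph1 /= expr2; apply: oppr_inj.
  by rewrite -[RHS](lam2 a aM) epsE // mulrACA mulcii mulN1r.
by rewrite sqrf_eq1 => /orP[] /eqP ->; [left|right].
Qed.

Lemma weights_sign_eq J eps eps' : has_weights J (sign_wt eps) ->
  has_weights J (sign_wt eps') ->
  {in t_roots F, eps =1 eps'}.
Proof.
move=> H H' d /t_rootsP[a aM ->]; have := H a 1 aM; rewrite H' //.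
move/(u_vec_inj (RM_root aM)); rewrite !mulr1 /sign_wt.
by move/(mulfI (i_neq0 R))/complexI.
Qed.

Lemma sign_eq_weights J J' eps eps' : has_weights J (sign_wt eps) ->
  has_weights J' (sign_wt eps') ->
  {in t_roots F, eps =1 eps'} -> J = J'.
Proof.
move=> H H' E; apply: (weights_eq H H') => a /kt_t_roots/E.
by rewrite /sign_wt => ->.
Qed.

Lemma sign_family_eq eps eps' : sign_family eps -> sign_family eps' ->
  {in pos_t_roots F, eps =1 eps'} -> {in t_roots F, eps =1 eps'}.
Proof.
move=> S S' E d dR; have [dP|dP] := boolP (d \in pos_t_roots F); first exact: E.
have [_ ->] := S d dR; have [_ ->] := S' d dR.
by rewrite E // t_roots_pos.
Qed.

(** * Complexification of m *)

Lemma m_mC (x : gR) : x \in m -> (x : g) \in mC F.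
Proof.
move=> xm; rewrite [x](coord_vbasis xm).
have E : (\sum_(i < \dim m) coord (vbasis m) i x *: (vbasis m)`_i : gR) =
   \sum_(i < \dim m) (coord (vbasis m) i x)%:C%C *: ((vbasis m)`_i : g) :> g by [].
rewrite E; apply: rpred_sum => i _; apply: rpredZ; apply: memv_span.
by apply: mem_nth; rewrite size_tuple.
Qed.

(** The two vectors are X_a - X_{-a} and i (X_a + X_{-a}), a real basis of u_a; this places X_a in
    the complex span of m. *)
Lemma X_u_vec a : X a = 2%:R^-1 *: (u_vec 1 a - 'i%C *: u_vec 'i%C a).
Proof.
have two0 : 2%:R != 0 :> C by rewrite pnatr_eq0.
apply: (scalerI two0); rewrite scalerA divff // scale1r.
rewrite /u_vec conjc1 conjci !scale1r scalerBr !scalerA mulrN mulcii opprK !scale1r.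
rewrite scaleN1r opprD opprK scaler_nat mulr2n.
by rewrite opprK addrACA addNr addr0.
Qed.

Lemma X_mC a : a \in RM -> X a \in mC F.
Proof.
move=> aM; rewrite X_u_vec; apply: rpredZ; apply: rpredB; first exact/m_mC/u_vec_m.
by apply: rpredZ; exact/m_mC/u_vec_m.
Qed.

Lemma given_by_weights J eps : sign_family eps -> given_by J eps ->
  has_weights J (sign_wt eps).
Proof.
move=> epsS [JC JCext JCX] a z aM; have NaM := RMN aM.
have := JCext (vsproj m (u_vec z a)); rewrite vsprojK ?u_vec_m //.
rewrite -/(m_fun J (u_vec z a)) => <-.
pose f (x : g) : g := vsval (JC (vsproj (mC F) x)).
have fE p q (x y : g) : f (p *: x - q *: y) = p *: f x - q *: f y.
  by rewrite /f !(linearB, linearZ).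
rewrite -[LHS]/(f (z *: X a - z^*%C *: X (- a))) fE /f !JCX //.
rewrite -/(sign_wt eps a) -/(sign_wt eps (- a)) sign_wt_conj //.
by rewrite /u_vec [(_ * z)^*%C]conjcM !scalerA [z * _]mulrC [z^*%C * _]mulrC.
Qed.

Lemma weights_given_by J eps : sign_family eps -> has_weights J (sign_wt eps) ->
  given_by J eps.
Proof.
move=> epsS HJ; pose D := weight_op (sign_wt eps).
(* The complex extension is [D] restricted to [mC]; the projection serves only to give the values
   the type of [mC]. *)
exists (linfun (vsproj (mC F)) \o (D \o linfun vsval))%VF => [x|a aM].
  rewrite !comp_lfunE !lfunE /= (vsprojK (m_mC (subvsP x))).
  have -> : vsval (J x) = m_fun J (vsval x) by rewrite /m_fun vsvalK.
  have Jm := m_fun_m J (vsval x); have DJ : D (vsval x) = m_fun J (vsval x).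
    move: (vsval x) (subvsP x) => {Jm}y; elim/m_ind: y / => [u v uE vE|a z aM|].
    - by rewrite m_funD -uE -vE linearD.
    - by rewrite HJ // weight_op_u_vec //; exact: sign_wt_conj.
    - by rewrite linear0 m_fun0.
  by rewrite DJ vsprojK // m_mC.
have XC := X_mC aM.
rewrite !comp_lfunE !lfunE /= (vsprojK XC) weight_op_X // vsprojK //.
exact: rpredZ.
Qed.

(** * Free choice of signs on the positive t-roots, and the count *)

Lemma sign_extension (s : dual_t F -> R) :
  {in pos_t_roots F, forall d, s d = 1 \/ s d = -1} ->
  exists2 eps, sign_family eps & {in pos_t_roots F, eps =1 s}.
Proof.
move=> s1; exists (fun d => if d \in pos_t_roots F then s d else - s (- d)).
  move=> d dR; have [dP|dP] := boolP (d \in pos_t_roots F).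
    by rewrite (negPf (pos_t_rootsN dP)) !opprK; split=> //; exact: s1.
  have NdP := t_roots_pos dR dP; rewrite NdP; split=> //.
  by case: (s1 _ NdP) => ->; [right|left; rewrite opprK].
by move=> d dP; rewrite dP.
Qed.

Lemma exists_unique_sign (s : dual_t F -> R) :
  {in pos_t_roots F, forall d, s d = 1 \/ s d = -1} ->
  exists! J, invariant_acs J /\
    exists2 eps, sign_family eps /\ given_by J eps & {in pos_t_roots F, eps =1 s}.
Proof.
move=> /sign_extension[eps epsS epss]; have [J Jinv HJ] := sign_exists epsS.
exists J; split=> [|J' [J'inv [eps' [epsS' J'g] epss']]].
  by split=> //; exists eps => //; split=> //; exact: weights_given_by.
apply: sign_eq_weights HJ (given_by_weights epsS' J'g) _.
by apply: sign_family_eq => // d dP; rewrite epss // epss'.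
Qed.

Lemma one_neqN1 : 1 != -1 :> R.
Proof. by rewrite -subr_eq0 opprK -mulr2n pnatr_eq0. Qed.

(** Structures correspond to subsets of the positive t-roots, the subset being where the sign is 1;
    the power set of a finite set provides the count. *)
Lemma card_invariant_acs :
  ([set J : 'End(subvs_of m) | invariant_acs J]
     #= `I_(2 ^ #|` pos_t_roots F|))%card.
Proof.
pose P := pos_t_roots F.
pose s (B : {fset dual_t F}) (d : dual_t F) : R := if d \in B then 1 else -1.
have s1 B : {in P, forall d, s B d = 1 \/ s B d = -1}.
  by move=> d _; rewrite /s; case: ifP; [left|right].
have [f fP] := choice (fun B => exists_unique_sign (s1 B)).
have f_inj : {in [set` fpowerset P] &, injective f}.
  move=> B B' /set_mem /=; rewrite fpowersetE => /fsubsetP BP.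
  move=> /set_mem /=; rewrite fpowersetE => /fsubsetP B'P fBB'.
  have [[_ [e [eS eg] es]] _] := fP B; have [[_ [e' [eS' eg'] es']] _] := fP B'.
  rewrite -fBB' in eg'.
  have E := weights_sign_eq (given_by_weights eS eg) (given_by_weights eS' eg').
  have mem d : d \in P -> (d \in B) = (d \in B').
    move=> dP; have := E d (pos_t_roots_sub dP); rewrite es // es' // /s.
    case: (d \in B); case: (d \in B') => //.
      by move/eqP; rewrite (negPf one_neqN1).
    by move/esym/eqP; rewrite (negPf one_neqN1).
  apply/fsetP => d; apply/idP/idP => dB; first by rewrite -(mem d (BP d dB)).
  by rewrite (mem d (B'P d dB)).
have -> : [set J | invariant_acs J] = f @` [set` fpowerset P].
  apply/seteqP; split=> [J Jinv|_ [B _ <-]]; last by have [[]] := fP B.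
  have [eps epsS HJ] := invariant_sign Jinv.
  exists [fset d in P | eps d == 1]%fset.
    by rewrite /= fpowersetE; apply/fsubsetP => d; rewrite !inE => /andP[].
  have [_] := fP [fset d in P | eps d == 1]%fset; apply; split=> //.
  exists eps; first by split=> //; exact: weights_given_by.
  move=> d dP; rewrite /s !inE dP /=.
  have [[->|->] _] := epsS d (pos_t_roots_sub dP); first by rewrite eqxx.
  by rewrite eq_sym (negPf one_neqN1).
rewrite (card_eql (inj_card_eq f_inj)).
by apply/card_eq_fsetP; rewrite card_fpowerset.
Qed.

End RootData.

Theorem proposition5p1 (R : realType) (g : lieAlgType R[i]) (F : flag_data g)
    (g_semisimple : semisimple g) :
  [/\ forall J : 'End(subvs_of (m_ F)), invariant_acs J ->
        exists2 eps : dual_t F -> R, sign_family eps /\ given_by J eps &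
          forall eps' : dual_t F -> R, sign_family eps' -> given_by J eps' ->
            {in t_roots F, eps' =1 eps},
      forall eps : dual_t F -> R, sign_family eps ->
        exists! J : 'End(subvs_of (m_ F)), invariant_acs J /\ given_by J eps,
      ([set J : 'End(subvs_of (m_ F)) | invariant_acs J]
        #= `I_(2 ^ #|` pos_t_roots F|))%card &
      forall s : dual_t F -> R,
        {in pos_t_roots F, forall d, s d = 1 \/ s d = -1} ->
        exists! J : 'End(subvs_of (m_ F)), invariant_acs J /\
          exists2 eps : dual_t F -> R, sign_family eps /\ given_by J eps &
            {in pos_t_roots F, eps =1 s}].
Proof.
split=> [J Jinv|eps epsS||s s1].
- have [eps epsS HJ] := invariant_sign g_semisimple Jinv.
  exists eps; first by split=> //; exact: weights_given_by.
  move=> eps' epsS' Jg; apply: (weights_sign_eq g_semisimple) HJ.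
  exact: given_by_weights.
- have [J Jinv HJ] := sign_exists g_semisimple epsS.
  exists J; split=> [|J' [_ Jg]]; first by split=> //; exact: weights_given_by.
  have HJ' := given_by_weights g_semisimple epsS Jg.
  by apply: (sign_eq_weights HJ HJ') => d _.
- exact: card_invariant_acs.
- exact: exists_unique_sign.
Qed.
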